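(* Let $H$ be a complex Hilbert space, let $T\in B(H)$ be power bounded with $\sigma_p(T)\cap\mathbb{T}=\emptyset$, and let $f\in P_m$ for some $m\in\mathbb{N}$. Then for every $x\in H$ $$ \lim_{N\to\infty}\frac{1}{N}\sum_{n=1}^N T^{[f(n)]}x=0 $$ in the norm of $H$; that is, these averages converge to $0$ in the strong operator topology.
   Context: $\mathbb{T}$ is the unit circle in $\mathbb{C}$, $\sigma_p(T)$ is the set of eigenvalues of $T$, $T$ is power bounded if $\sup_{n\ge0}\|T^n\|<\infty$, and $[\cdot]$ is the integer part. Convention: $T^{[f(n)]}=I$ if the exponent is negative or $f(n)$ is not defined (this concerns only finitely many $n$). Class $P_m$ ($m\in\mathbb{N}$, $m\ge1$): a continuous real function $f$ defined on some interval $[t_0,\infty)$ (functions agreeing for all large $t$ are identified) is of class $P_m$ if, for all $t$ large enough, $f$ has continuous derivatives $f',\dots,f^{(m)}$ with $f,f',\dots,f^{(m)}>0$, and $$\limsup_{t\to\infty}\frac{f^{(m-1)}(t)}{t f^{(m)}(t)}<\infty,\qquad \limsup_{t\to\infty}\sup\Bigl\{\frac{f^{(m)}(s)}{f^{(m)}(t)}: s\ge t\Bigr\}<\infty.$$ *)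

(* Defs.v *)
From HB Require Import structures.
From mathcomp Require Import all_boot all_order all_algebra.
From mathcomp Require Import complex.
From mathcomp Require Import all_classical all_reals all_analysis.
Import Order.TTheory GRing.Theory Num.Theory.
Import numFieldTopology.Exports numFieldNormedType.Exports.

Set Implicit Arguments.
Unset Strict Implicit.
Unset Printing Implicit Defensive.

Local Open Scope classical_set_scope.
Local Open Scope complex_scope.
Local Open Scope ring_scope.

(* [f : R -> R] represents a function defined on [t0, +oo[; its values to the
   left of [t0] are junk and no condition below depends on them. [f^`(k)] is
   the total iterated derivative, only meaningful where [derivable] holds, and
   "for all large t" is the filter [t --> +oo]. *)
Record class_P (R : realType) (m : nat) (t0 : R) (f : R -> R) : Prop := {
  class_P_order : (1 <= m)%N ;
  class_P_continuous : {within `[t0, +oo[, continuous f} ;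
  class_P_derivable : \forall t \near +oo,
    forall k, (k < m)%N -> derivable (f^`(k)%classic) t 1 ;
  class_P_continuous_deriv : \forall t \near +oo,
    forall k, (k <= m)%N -> {for t, continuous (f^`(k)%classic)} ;
  class_P_pos : \forall t \near +oo,
    forall k, (k <= m)%N -> 0 < f^`(k)%classic t ;
  class_P_limsup_ratio :
    (limf_esup (fun t : R => (f^`(m.-1)%classic t / (t * f^`(m)%classic t))%:E) +oo%R
       < +oo)%E ;
  class_P_limsup_sup :
    (limf_esup
       (fun t : R =>
          ereal_sup [set (f^`(m)%classic s / f^`(m)%classic t)%:E | s in `[t, +oo[ ])
       +oo%R
       < +oo)%E
}.

Section Operators.
Variables (R : realType) (H : normedModType R[i]).

(* The norm of [H] takes its (nonnegative real) values in [R[i]]. *)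
Definition op_norm (S : H -> H) : \bar R :=
  ereal_sup [set (complex.Re `|S x|)%:E | x in [set x : H | `|x| <= 1]].

Definition power_bounded (T : H -> H) : Prop :=
  (ereal_sup (range (fun n : nat => op_norm (iter n T))) < +oo)%E.

Definition point_spectrum (T : H -> H) : set R[i] :=
  [set lambda | exists2 v : H, v != 0 & T v = lambda *: v].

Definition unit_circle : set R[i] := [set z | `|z| = 1].

(* [T^[f(n)]], read as the identity when [n] lies outside the domain
   [t0, +oo[ of [f] or when the exponent is negative. *)
Definition pow_floor (T : H -> H) (t0 : R) (f : R -> R) (n : nat) : H -> H :=
  if (t0 <= n%:R) && (0 <= Num.floor (f n%:R))
  then iter `|Num.floor (f n%:R)|%N T else id.

End Operators.
Arguments unit_circle {R}.

(* Main.v *)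
(** Write [null a x] when the averages of [c n T^(a n) x] tend to [0] uniformly
    over all real coefficients with [|c n| <= 1].

    Exponents [a n = n]. Minimising the norm over the vectors [v] with [T v]
    close to [v] and [x - v] a coboundary gives the mean ergodic theorem for
    [z T], [|z| = 1]; compactness of the circle makes it uniform in [z]. By
    Parseval on a cyclic group, the convolution of [c] with the orbit of [x] is
    then small in mean square, hence small somewhere, and power boundedness
    transports this to all later windows.

    Case [m = 1]. Every value of [floor (f n)], [n <= N], is taken [O(N / f N)]
    times, so the sum reduces to the previous one with rescaled coefficients.

    Induction on [m]. A van der Corput argument reduces [floor (u n)] to the
    differences [u (n + h) - u n]. The correlations
    [<T^(d + j) x, T^j x>] are not independent of [j], [T] not being isometric;
    but lowering all exponents of a window increases its norm at most by a
    constant factor, so one may average over [j] in a range [j < J] which is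
    long compared with the variation of the exponents over a short block. Then
    [j] decouples from the position in the block, and since [T^d] and [T^j]
    commute, the induction hypothesis for the differences applies. The arbitrary
    coefficients absorb the discrepancy between
    [floor (u (n + h)) - floor (u n)] and [floor (u (n + h) - u n)].

    For [f] in the class [P_m], the mean value theorem for iterated differences
    shows that all [(m - 1)]-fold differences of [f n] behave as in case
    [m = 1]. *)

Require Import Defs.
From HB Require Import structures.
From mathcomp Require Import all_boot all_order all_algebra.
From mathcomp Require Import complex.
From mathcomp Require Import all_classical all_reals all_analysis.
From mathcomp Require Import ring lra zify.
Import Order.TTheory GRing.Theory Num.Theory.
Import numFieldTopology.Exports numFieldNormedType.Exports.

Set Implicit Arguments.
Unset Strict Implicit.
Unset Printing Implicit Defensive.

Local Open Scope classical_set_scope.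
Local Open Scope complex_scope.
Local Open Scope ring_scope.

(** * Real-valued norm and inner product *)

Section RealNorm.
Variables (R : realType) (H : completeNormedModType R[i]).
Implicit Types (u v : H) (z : R[i]).

(** The norm of [H] takes values in [R[i]]; real parts move all estimates to the totally ordered
    field [R]. *)
Definition rnorm v : R := complex.Re `|v|.
Definition cabs z : R := complex.Re `|z|.

Lemma rnormE v : `|v| = (rnorm v)%:C.
Proof. by rewrite /rnorm RRe_real ?ger0_real. Qed.

Lemma cabsE z : `|z| = (cabs z)%:C.
Proof. by rewrite /cabs RRe_real ?ger0_real. Qed.

Lemma rnorm_ge0 v : 0 <= rnorm v.
Proof. by rewrite -lecR -rnormE normr_ge0. Qed.

Lemma cabs_ge0 z : 0 <= cabs z.
Proof. by rewrite -lecR -cabsE normr_ge0. Qed.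

Lemma rnorm0 : rnorm 0 = 0.
Proof. by rewrite /rnorm normr0. Qed.

Lemma rnorm_eq0 v : rnorm v = 0 -> v = 0.
Proof. by move=> v0; apply/eqP; rewrite -normr_eq0 rnormE v0. Qed.

Lemma rnormD u v : rnorm (u + v) <= rnorm u + rnorm v.
Proof. by rewrite -lecR rmorphD /= -!rnormE ler_normD. Qed.

Lemma rnormN v : rnorm (- v) = rnorm v.
Proof. by rewrite /rnorm normrN. Qed.

Lemma rnormB u v : rnorm (u - v) <= rnorm u + rnorm v.
Proof. by rewrite -(rnormN v) rnormD. Qed.

Lemma rnormBC u v : rnorm (u - v) = rnorm (v - u).
Proof. by rewrite -opprB rnormN. Qed.

Lemma rnormZ z v : rnorm (z *: v) = cabs z * rnorm v.
Proof.
by apply: (@complexI R); rewrite rmorphM /= -rnormE -cabsE -rnormE normrZ.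
Qed.

Lemma cabsM z z' : cabs (z * z') = cabs z * cabs z'.
Proof.
by apply: (@complexI R); rewrite rmorphM /= -!cabsE normrM.
Qed.

Lemma cabsX z n : cabs (z ^+ n) = cabs z ^+ n.
Proof. by apply: (@complexI R); rewrite rmorphXn /= -!cabsE normrX. Qed.

Lemma cabs_real (a : R) : cabs a%:C = `|a|.
Proof. by rewrite /cabs normc_def /= expr0n /= addr0 sqrtr_sqr. Qed.

Lemma rnormMn v n : rnorm (v *+ n) = n%:R * rnorm v.
Proof.
by apply: (@complexI R); rewrite rmorphM rmorph_nat /= -!rnormE normrMn mulr_natl.
Qed.

Lemma rnorm_sum (I : Type) (r : seq I) (P : pred I) (F : I -> H) :
  rnorm (\sum_(i <- r | P i) F i) <= \sum_(i <- r | P i) rnorm (F i).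
Proof.
elim/big_ind2: _ => [|x a y b xa yb|//]; first by rewrite rnorm0.
by apply: (le_trans (rnormD _ _)); rewrite lerD.
Qed.

Lemma rnormZ_le (c : R) v : `|c| <= 1 -> rnorm (c%:C *: v) <= rnorm v.
Proof. by move=> c1; rewrite rnormZ cabs_real ler_piMl ?rnorm_ge0. Qed.

Variable ip : {dot H for (@Num.conj R[i])}.
Hypothesis ip_norm : forall x : H, `|x| ^+ 2 = ip x x.

Definition rip u v : R := complex.Re (ip u v).

Lemma ripDl u u' v : rip (u + u') v = rip u v + rip u' v.
Proof. by rewrite /rip linearDl raddfD. Qed.

Lemma ipC u v : ip v u = (ip u v)^*%C.
Proof. by rewrite (@hermC _ _ _ _ ip) /= expr0 mul1r. Qed.

Lemma ripC u v : rip v u = rip u v.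
Proof. by rewrite /rip ipC; case: (ip u v). Qed.

Lemma ripDr u v v' : rip u (v + v') = rip u v + rip u v'.
Proof. by rewrite ripC ripDl !(ripC u). Qed.

Lemma ripZ z z' u v :
  rip (z *: u) (z' *: v) = complex.Re (z * z'^*%C * ip u v).
Proof. by rewrite /rip linearZl_LR linearZr_LR /= mulrA. Qed.

Lemma ripZZ (a b : R) u v : rip (a%:C *: u) (b%:C *: v) = a * b * rip u v.
Proof.
rewrite ripZ conjc_real /rip; case: (ip u v) => x y /=.
by rewrite !(mul0r, mulr0, addr0, subr0).
Qed.

Lemma ripZl (a : R) u v : rip (a%:C *: u) v = a * rip u v.
Proof. by have := ripZZ a 1 u v; rewrite scale1r mulr1. Qed.

Lemma rip0l v : rip 0 v = 0.
Proof. by rewrite -(scale0r v) (ripZl 0) mul0r. Qed.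

Lemma ripNl u v : rip (- u) v = - rip u v.
Proof. by apply/eqP; rewrite -addr_eq0 -ripDl addNr rip0l. Qed.

Lemma ripNr u v : rip u (- v) = - rip u v.
Proof. by rewrite ripC ripNl ripC. Qed.

Lemma rip_suml (I : Type) (r : seq I) (P : pred I) (F : I -> H) v :
  rip (\sum_(i <- r | P i) F i) v = \sum_(i <- r | P i) rip (F i) v.
Proof.
apply: (big_morph (fun u => rip u v)); last exact: rip0l.
by move=> x y; rewrite ripDl.
Qed.

Lemma rip_sumr (I : Type) (r : seq I) (P : pred I) (F : I -> H) v :
  rip v (\sum_(i <- r | P i) F i) = \sum_(i <- r | P i) rip v (F i).
Proof. by rewrite ripC rip_suml; apply: eq_bigr => i _; rewrite ripC. Qed.

Lemma ripvv v : rip v v = rnorm v ^+ 2.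
Proof. by rewrite /rip -ip_norm rnormE -rmorphXn. Qed.

Lemma rnormD_sqr u v :
  rnorm (u + v) ^+ 2 = rnorm u ^+ 2 + rnorm v ^+ 2 + 2 * rip u v.
Proof. by rewrite -!ripvv ripDl !ripDr (ripC v u); ring. Qed.

Lemma rnorm_parallelogram u v :
  rnorm (u - v) ^+ 2 = 2 * rnorm u ^+ 2 + 2 * rnorm v ^+ 2 - rnorm (u + v) ^+ 2.
Proof. by rewrite !rnormD_sqr rnormN ripNr; ring. Qed.

(** Expanding the squared norm of [|b| a - |a| b] and dividing by [|a| |b|] bounds [rip a b] from
    above; the lower bound follows by replacing [u] with [- u]. *)
Lemma rip_CS u v : `|rip u v| <= rnorm u * rnorm v.
Proof.
have key a b : rip a b <= rnorm a * rnorm b.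
  have [a0|a0] := eqVneq (rnorm a) 0.
    by rewrite (rnorm_eq0 a0) rip0l rnorm0 mul0r.
  have [b0|b0] := eqVneq (rnorm b) 0.
    by rewrite ripC (rnorm_eq0 b0) rip0l rnorm0 mulr0.
  have pa : 0 < rnorm a by rewrite lt_def a0 rnorm_ge0.
  have pb : 0 < rnorm b by rewrite lt_def b0 rnorm_ge0.
  have : 0 <= rnorm ((rnorm b)%:C *: a - (rnorm a)%:C *: b) ^+ 2.
    exact: sqr_ge0.
  rewrite rnormD_sqr rnormN ripNr ripZZ !rnormZ !cabs_real.
  rewrite !(ger0_norm (rnorm_ge0 _)) => h.
  rewrite -(ler_pM2l (mulr_gt0 pa pb)); nra.
rewrite ler_norml key andbT lerNl -ripNl.
by rewrite -(rnormN u) key.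
Qed.

End RealNorm.

(** * The mean ergodic theorem *)

Section MeanErgodic.
Variables (R : realType) (H : completeNormedModType R[i]).
Variable ip : {dot H for (@Num.conj R[i])}.
Hypothesis ip_norm : forall x : H, `|x| ^+ 2 = ip x x.
Implicit Types (u v x : H).

Lemma iter_linD (S : {linear H -> H}) n u v :
  iter n S (u + v) = iter n S u + iter n S v.
Proof. by elim: n => //= n ->; rewrite linearD. Qed.

Lemma iter_linN (S : {linear H -> H}) n u : iter n S (- u) = - iter n S u.
Proof. by elim: n => //= n ->; rewrite linearN. Qed.

Lemma iter_linZ (S : {linear H -> H}) n (a : R[i]) u :
  iter n S (a *: u) = a *: iter n S u.
Proof. by elim: n => //= n ->; rewrite linearZ. Qed.

Lemma iter_lin0 (S : {linear H -> H}) n : iter n S 0 = 0.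
Proof. by elim: n => //= n ->; rewrite linear0. Qed.

Lemma iter_lin_sum (S : {linear H -> H}) n (I : Type) (r : seq I) (P : pred I)
    (F : I -> H) :
  iter n S (\sum_(i <- r | P i) F i) = \sum_(i <- r | P i) iter n S (F i).
Proof.
apply: (big_morph (iter n S)); last exact: iter_lin0.
by move=> u v; rewrite iter_linD.
Qed.

(** Completeness of [H] with real tolerances: a positive element of [R[i]] is real, so the two
    Cauchy conditions agree. *)
Lemma rnorm_complete (v : nat -> H) :
  (forall e : R, 0 < e -> exists N, forall n k,
     (N <= n)%N -> (N <= k)%N -> rnorm (v n - v k) <= e) ->
  exists z, forall e : R, 0 < e -> exists N, forall n,
     (N <= n)%N -> rnorm (v n - z) <= e.
Proof.
move=> vC.
have : cvg (v @ \oo).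
  apply: cauchy_cvg; apply/cauchyP => e e0.
  have er : e = (complex.Re e)%:C by rewrite RRe_real ?gtr0_real.
  have e'0 : 0 < complex.Re e by rewrite -ltcR -er.
  have [N NP] := vC (complex.Re e / 2) (divr_gt0 e'0 (ltr0Sn _ _)).
  exists (v N); exists N => // n /= Nn.
  rewrite -ball_normE /= rnormE er ltcR.
  by apply: le_lt_trans (NP N n (leqnn N) Nn) _; rewrite ltr_pdivrMr // ltr_pMr // ltr1n.
move=> /cvg_ex [z vz]; exists z => e e0.
have e'0 : 0 < e%:C :> R[i] by rewrite ltcR.
have /cvgrPdist_le /(_ _ e'0) := vz.
move=> [N _ NP]; exists N => n Nn.
by rewrite rnormBC -lecR -rnormE; apply: NP.
Qed.

Variables (S : {linear H -> H}) (K : R).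
Hypothesis K1 : 1 <= K.
Hypothesis SK : forall n v, rnorm (iter n S v) <= K * rnorm v.

Let SK1 v : rnorm (S v) <= K * rnorm v. Proof. exact: (SK 1). Qed.

Let coboundary v := exists u, v = S u - u.

Let coboundaryD u v : coboundary u -> coboundary v -> coboundary (u + v).
Proof.
by move=> [a ->] [b ->]; exists (a + b); rewrite linearD opprD addrACA.
Qed.

Let coboundaryZ a u : coboundary u -> coboundary (a *: u).
Proof. by move=> [b ->]; exists (a *: b); rewrite linearZ scalerBr. Qed.

Lemma sum_iter_coboundary N u :
  \sum_(i < N) iter i S (S u - u) = iter N S u - u.
Proof.
elim: N => [|N IH]; first by rewrite big_ord0 subrr.
rewrite big_ord_recr /= IH iter_linD iter_linN -iterSr /=.
by rewrite addrC addrA subrK.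
Qed.

(** Each [x - S^i x] is a coboundary by telescoping, and coboundaries are closed under sums and
    multiples. *)
Let coboundary_avg (N : nat) x :
  coboundary (x - N.+1%:R^-1%:C *: \sum_(i < N.+1) iter i S x).
Proof.
suff cN M : coboundary (M%:R%:C *: x - \sum_(i < M) iter i S x).
  have := coboundaryZ N.+1%:R^-1%:C (cN N.+1).
  by rewrite scalerBr scalerA -rmorphM /= mulVf ?pnatr_eq0 // scale1r.
have ci i : coboundary (x - iter i S x).
  have -> : x - iter i S x = (-1) *: (iter i S x - x).
    by rewrite scaleN1r opprB.
  apply: coboundaryZ; rewrite -sum_iter_coboundary.
  elim: i => [|i IH]; first by rewrite big_ord0; exists 0; rewrite linear0 subrr.
  rewrite big_ord_recr /=; apply: coboundaryD => //.
  by exists (iter i S x); rewrite iter_linD iter_linN -iterS -iterSr.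
elim: M => [|M IH].
  by rewrite big_ord0 scale0r subrr; exists 0; rewrite linear0 subrr.
rewrite big_ord_recr /= -natr1 rmorphD /= scalerDl scale1r opprD addrACA.
exact: coboundaryD.
Qed.

Lemma rnorm_avg_coboundary N u :
  rnorm (\sum_(i < N) iter i S (S u - u)) <= 2 * K * rnorm u.
Proof.
rewrite sum_iter_coboundary; apply: le_trans (rnormB _ _) _.
have h := SK N u.
have h' : rnorm u <= K * rnorm u by rewrite ler_peMl ?rnorm_ge0.
by apply: (le_trans (lerD h h')); rewrite -mulrA mulr2n mulrDl mul1r.
Qed.

Lemma sum_iter_bound N v : rnorm (\sum_(i < N) iter i S v) <= N%:R * (K * rnorm v).
Proof.
apply: le_trans (rnorm_sum _ _ _) _.
apply: (@le_trans _ _ (\sum_(i < N) K * rnorm v)); first exact: ler_sum.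
by rewrite sumr_const card_ord -(mulr_natl (K * rnorm v)) lexx.
Qed.

Let iv (n : nat) : R := n.+1%:R^-1.

Let iv_gt0 n : 0 < iv n. Proof. by rewrite invr_gt0 ltr0n. Qed.

Let iv_anti n k : (n <= k)%N -> iv k <= iv n.
Proof. by move=> nk; rewrite lef_pV2 ?posrE ?ltr0n // ler_nat. Qed.

Let iv_lim (e : R) : 0 < e -> exists N, iv N <= e.
Proof.
move=> e0; exists (Num.truncn e^-1).
by rewrite invf_ple ?posrE ?ltr0n // ltW // truncnS_gt.
Qed.

(* The vectors [v] of [E n] form a decreasing family of convex sets; by the
   parallelogram identity almost norm-minimising elements form a Cauchy
   sequence, whose limit is a fixed point of [S], hence [0]. *)
Lemma approx_coboundary x :
  (forall v, S v = v -> v = 0) ->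
  forall e : R, 0 < e -> exists u v, x = (S u - u) + v /\ rnorm v <= e.
Proof.
move=> noeig.
pose E (n : nat) : set H :=
  [set v | rnorm (S v - v) <= iv n /\ coboundary (x - v)].
pose m n := inf [set rnorm v | v in E n].
have Emono n k : (n <= k)%N -> E k `<=` E n.
  move=> nk v [Sv cv]; split => //; exact: le_trans Sv (iv_anti nk).
(* A Cesaro mean of [x] of length [N + 1] lies in [E n]: applying [S - 1] telescopes to a vector of
   norm at most [2 K |x| / (N + 1)]. The norm bound [K |x|], independent of [n], keeps the infima
   [m n] bounded. *)
have Eavg n : exists2 v, E n v & rnorm v <= K * rnorm x.
  have K0 : 0 <= K := le_trans ler01 K1.
  have [N NP] := iv_lim
    (divr_gt0 (iv_gt0 n) (ltr_pwDr ltr01 (mulr_ge0 (mulr_ge0 (ler0n _ 2) K0) (rnorm_ge0 x)))).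
  exists ((iv N)%:C *: \sum_(i < N.+1) iter i S x).
    split; last exact: (coboundary_avg N x).
    rewrite linearZ -scalerBr /= linear_sum -sumrB.
    under eq_bigr do rewrite -iterS iterSr -iter_linN -iter_linD.
    rewrite rnormZ cabs_real ger0_norm ?(ltW (iv_gt0 _)) //.
    apply: le_trans (ler_wpM2l (ltW (iv_gt0 N)) (rnorm_avg_coboundary _ x)) _.
    have c0 : 0 <= 2 * K * rnorm x by rewrite !mulr_ge0 ?rnorm_ge0.
    apply: le_trans (ler_wpM2r c0 NP) _.
    rewrite mulrAC -mulrA ler_piMr ?(ltW (iv_gt0 _)) // ler_pdivrMr; lra.
  rewrite rnormZ cabs_real ger0_norm ?(ltW (iv_gt0 _)) //.
  apply: le_trans (ler_wpM2l (ltW (iv_gt0 N)) (sum_iter_bound _ x)) _.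
  by rewrite mulKf ?pnatr_eq0.
have lbE n : has_lbound [set rnorm v | v in E n].
  by exists 0 => _ [v _ <-]; exact: rnorm_ge0.
have neE n : [set rnorm v | v in E n] !=set0.
  by have [v vE _] := Eavg n; exists (rnorm v), v.
have m_le n v : E n v -> m n <= rnorm v.
  by move=> vE; apply: ge_inf => //; exists v.
have m_ge0 n : 0 <= m n.
  by apply: lb_le_inf => // _ [v _ <-]; exact: rnorm_ge0.
have m_bd n : m n <= K * rnorm x.
  by have [v /m_le vE vK] := Eavg n; exact: le_trans vE vK.
have m_mono n k : (n <= k)%N -> m n <= m k.
  move=> nk; apply: lb_le_inf => // _ [v vE <-].
  by apply: m_le; exact: Emono nk _ vE.
have /choice [v vP] n : exists v, E n v /\ rnorm v <= m n + iv n.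
  have [_ [v vE <-] vm] := inf_adherent (iv_gt0 n) (conj (neE n) (lbE n)).
  by exists v; split=> //; exact: ltW.
pose M := sup (range m).
have ubM : has_ubound (range m) by exists (K * rnorm x) => _ [n _ <-].
have neM : range m !=set0 by exists (m 0); exists 0.
have mM n : m n <= M by apply: ub_le_sup => //; exists n.
have M0 : 0 <= M by apply: le_trans (m_ge0 0) (mM 0).
(* The midpoint of [v n] and [v k] stays in the convex set [E n], so its norm is at least [m n]. *)
have mid n k : (n <= k)%N -> 2 * m n <= rnorm (v n + v k).
  move=> nk.
  have [[Sn cn] _] := vP n; have [/(Emono _ _ nk) [Sk ck] _] := vP k.
  have h2 : E n ((2^-1)%:C *: (v n + v k)).
    have half (a b : H) : x - (2^-1)%:C *: (a + b) =
        (2^-1)%:C *: ((x - a) + (x - b)).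
      rewrite [in RHS]addrACA -opprD [RHS]scalerBr -mulr2n -(scaler_nat 2 x) scalerA.
      by rewrite fmorphV rmorph_nat mulVf ?pnatr_eq0 // scale1r.
    split; last first.
      by rewrite half; apply: coboundaryZ; apply: coboundaryD.
    rewrite linearZ /= -scalerBr (linearD S) opprD addrACA rnormZ cabs_real.
    rewrite ger0_norm ?invr_ge0 ?ler0n //.
    apply: le_trans (ler_wpM2l _ (rnormD _ _)) _; first by rewrite invr_ge0.
    apply: le_trans (ler_wpM2l _ (lerD Sn Sk)) _; first by rewrite invr_ge0.
    by rewrite -mulr2n -[X in _ * X <= _]mulr_natl mulKf ?pnatr_eq0.
  have := m_le _ _ h2; rewrite rnormZ cabs_real ger0_norm ?invr_ge0 ?ler0n //.
  by rewrite mulrC ler_pdivlMr // mulrC.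
have dist n k : (n <= k)%N ->
    rnorm (v n - v k) ^+ 2 <= 4 * ((M + iv n) ^+ 2 - m n ^+ 2).
  move=> nk; rewrite (rnorm_parallelogram ip_norm).
  have ik : iv k <= iv n by exact: iv_anti.
  have hn : rnorm (v n) ^+ 2 <= (M + iv n) ^+ 2.
    rewrite ler_sqr ?nnegrE ?rnorm_ge0 ?addr_ge0 ?(ltW (iv_gt0 _)) //.
    by apply: le_trans (vP n).2 _; rewrite lerD2r.
  have hk : rnorm (v k) ^+ 2 <= (M + iv n) ^+ 2.
    rewrite ler_sqr ?nnegrE ?rnorm_ge0 ?addr_ge0 ?(ltW (iv_gt0 _)) //.
    by apply: le_trans (vP k).2 _; rewrite lerD.
  have hs : (2 * m n) ^+ 2 <= rnorm (v n + v k) ^+ 2.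
    by rewrite ler_sqr ?nnegrE ?rnorm_ge0 ?mulr_ge0 // mid.
  by rewrite exprMn in hs; lra.
have vC : forall e : R, 0 < e -> exists N, forall n k,
    (N <= n)%N -> (N <= k)%N -> rnorm (v n - v k) <= e.
  move=> e e0.
  (* With this [d], the difference of squares in [dist] factors into at most [2 d] times [2 M + 1],
     and four times this product is at most [e ^+ 2]. *)
  pose d := Num.min 1 (e ^+ 2 / (4 * (4 * M + 2))).
  have e20 : 0 < e ^+ 2 by rewrite exprn_gt0.
  have c0 : 0 < 4 * (4 * M + 2) by lra.
  have d0 : 0 < d by rewrite lt_min ltr01 /= divr_gt0.
  have d1 : d <= 1 by rewrite ge_min lexx.
  have dM : d * (4 * (4 * M + 2)) <= e ^+ 2.
    by rewrite -ler_pdivlMr // ge_min lexx orbT.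
  have [_ [N1 _ <-] mN1] := sup_adherent d0 (conj neM ubM).
  have [N2 N2P] := iv_lim d0.
  pose N := maxn N1 N2.
  have key n k : (N <= n)%N -> (n <= k)%N -> rnorm (v n - v k) <= e.
    move=> Nn nk.
    rewrite -ler_sqr ?nnegrE ?rnorm_ge0 ?(ltW e0) //.
    apply: le_trans (dist _ _ nk) _.
    have h1 : iv n <= d.
      apply: le_trans _ N2P; apply: iv_anti.
      by apply: leq_trans Nn; exact: leq_maxr.
    have h2 : M - d <= m n.
      apply: le_trans (ltW mN1) _; apply: m_mono.
      by apply: leq_trans Nn; exact: leq_maxl.
    have h3 := iv_gt0 n; have h4 := m_ge0 n; have h5 := mM n.
    have : (M + iv n) ^+ 2 - m n ^+ 2 =
      (M + iv n - m n) * (M + iv n + m n) by ring.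
    move=> ->.
    have : (M + iv n - m n) * (M + iv n + m n)
        <= (2 * d) * (2 * M + 1).
      by apply: ler_pM; lra.
    lra.
  exists N => n k Nn Nk; have [nk|kn] := leqP n k; first exact: key.
  by rewrite rnormBC; apply: key => //; exact: ltnW.
have [z zP] := rnorm_complete vC.
have K0 : 0 < K := lt_le_trans ltr01 K1.
(* [S z - z] differs from the small vector [S (v N) - v N] by at most [2 K |z - v N|]. *)
have Sz : S z = z.
  apply/eqP; rewrite -subr_eq0; apply/eqP; apply: rnorm_eq0.
  apply/eqP; rewrite eq_le rnorm_ge0 andbT; apply/ler_addgt0Pl => e e0.
  have e'0 : 0 < e / (3 * K) by rewrite divr_gt0 // mulr_gt0.
  have [N1 N1P] := zP _ e'0.
  have e30 : 0 < e / 3 by rewrite divr_gt0.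
  have [N2 N2P] := iv_lim e30.
  pose N := maxn N1 N2.
  have := N1P N (leq_maxl _ _); have [[SN _] _] := vP N.
  have iN : iv N <= e / 3.
    by apply: le_trans N2P; apply: iv_anti; exact: leq_maxr.
  rewrite ler_pdivlMr ?mulr_gt0 // => vz.
  have -> : S z - z = (S (v N) - v N) + (S (z - v N) - (z - v N)).
    by rewrite [RHS]addrC linearB /= opprB addrACA subrK (addrAC (v N)) subrr add0r.
  have h1 := rnormD (S (v N) - v N) (S (z - v N) - (z - v N)).
  have h2 := rnormB (S (z - v N)) (z - v N).
  have h3 := SK1 (z - v N).
  have h4 : rnorm (z - v N) <= K * rnorm (z - v N) by rewrite ler_peMl ?rnorm_ge0.
  rewrite (rnormBC (v N)) in vz; lra.
move=> e e0.
have [N NP] := zP _ e0.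
have [[_ [u cu]] _] := vP N.
exists u, (v N); split; first by rewrite -cu subrK.
by have := NP _ (leqnn N); rewrite (noeig _ Sz) subr0.
Qed.

(** After splitting [x] by [approx_coboundary], the coboundary part has bounded sums, and the
    remainder contributes at most [e / 2] per term. *)
Theorem mean_ergodic x :
  (forall v, S v = v -> v = 0) ->
  forall e : R, 0 < e -> exists N0, forall N, (N0 <= N)%N ->
    rnorm (\sum_(i < N) iter i S x) <= e * N%:R.
Proof.
move=> noeig e e0.
have K0 : 0 < K := lt_le_trans ltr01 K1.
have e'0 : 0 < e / (2 * K) by rewrite divr_gt0 // mulr_gt0.
have [u [v [-> ve]]] := approx_coboundary x noeig e'0.
have [N0 N0P] : exists N0 : nat, 4 * K * rnorm u / e <= N0%:R.
  exists (Num.truncn (4 * K * rnorm u / e)).+1; exact/ltW/truncnS_gt.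
exists N0 => N N0N.
under eq_bigr do rewrite iter_linD.
rewrite big_split /=; apply: le_trans (rnormD _ _) _.
have h1 := rnorm_avg_coboundary N u; have h2 := sum_iter_bound N v.
have NR : N0%:R <= N%:R :> R by rewrite ler_nat.
move: ve; rewrite ler_pdivlMr ?mulr_gt0 // => ve.
move: N0P; rewrite ler_pdivrMr // => N0P.
have h3 : N0%:R * e <= N%:R * e by rewrite ler_pM2r.
have h4 : N%:R * (K * rnorm v * 2) <= N%:R * e.
  by rewrite ler_wpM2l ?ler0n //; lra.
lra.
Qed.

End MeanErgodic.

(** * Uniformity over the unit circle *)

Section Cis.
Variable R : realType.
Implicit Types (s t : R).

Definition cis t : R[i] := Complex (cos t) (sin t).

Lemma cis0 : cis 0 = 1.
Proof. by rewrite /cis cos0 sin0. Qed.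

Lemma cisD s t : cis (s + t) = cis s * cis t.
Proof.
rewrite /cis cosD sinD; apply/eqP; rewrite eq_complex /=.
by apply/andP; split; apply/eqP; ring.
Qed.

Lemma cisX t n : cis t ^+ n = cis (n%:R * t).
Proof.
elim: n => [|n IH]; first by rewrite mul0r cis0.
by rewrite exprSr IH -cisD -natr1 mulrDl mul1r.
Qed.

Lemma cabs_cis t : cabs (cis t) = 1.
Proof.
by rewrite /cabs normc_def /= cos2Dsin2 sqrtr1.
Qed.

Lemma cisJ t : (cis t)^*%C * cis t = 1.
Proof.
rewrite mulrC -sqr_normc cabsE cabs_cis; exact: expr1n.
Qed.

Lemma cabs_le_ReIm (z : R[i]) : cabs z <= `|complex.Re z| + `|complex.Im z|.
Proof.
rewrite /cabs normc_def /= -[leRHS]ger0_norm ?addr_ge0 // -sqrtr_sqr.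
rewrite ler_wsqrtr // sqrrD !real_normK ?num_real // addrAC lerDl.
by rewrite mulrn_wge0 // mulr_ge0.
Qed.

Lemma cis_cvg t (e : R) : 0 < e -> \forall s \near t, cabs (cis s - cis t) <= e.
Proof.
move=> e0; have e20 : 0 < e / 2 by rewrite divr_gt0.
have /cvgrPdist_le /(_ _ e20) hc := @continuous_cos R t.
have /cvgrPdist_le /(_ _ e20) hs := @continuous_sin R t.
near=> s; apply: le_trans (cabs_le_ReIm _) _ => /=.
rewrite [leRHS]splitr lerD // distrC.
  by near: s.
by near: s.
Unshelve. all: by end_near. Qed.

(** Orthogonality of the characters of the cyclic group of order [N]: for [p != q] the sum is
    geometric with ratio [w ^+ d], [d = p - q], and [w ^+ N = 1]. *)
Lemma cis_sum0 (N p q : nat) : (p < N)%N -> (q < N)%N ->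
  \sum_(k < N) cis (2 * pi / N%:R) ^+ (k * p) * (cis (2 * pi / N%:R) ^+ (k * q))^*%C
  = (if p == q then N else 0)%:R.
Proof.
wlog pq : p q / (q <= p)%N.
  move=> h pN qN; have [/h/(_ pN qN) //|/ltnW /h/(_ qN pN)] := leqP q p.
  rewrite eq_sym => /(congr1 (@conjc R)); rewrite conjc_nat => <-.
  by rewrite rmorph_sum /=; apply: eq_bigr => k _; rewrite rmorphM /= conjcK mulrC.
move=> pN _; have N0 : (0 < N)%N by exact: leq_ltn_trans pN.
set w := cis _.
have wJ n : (w ^+ n)^*%C * w ^+ n = 1.
  by rewrite cisX cisJ.
have [<-|npq] := eqVneq p q.
  under eq_bigr do rewrite mulrC wJ.
  by rewrite sumr_const card_ord.
have qp : (q < p)%N by rewrite ltn_neqAle eq_sym npq.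
pose d := (p - q)%N.
have dN : (d < N)%N by rewrite (leq_ltn_trans (leq_subr _ _)).
have d0 : (0 < d)%N by rewrite subn_gt0.
rewrite (eq_bigr (fun k : 'I_N => (w ^+ d) ^+ k)); last first.
  move=> k _.
  by rewrite -(subnK pq) mulnDr exprD -mulrA [X in _ * X]mulrC wJ mulr1 mulnC exprM.
apply: (@mulfI _ (w ^+ d - 1)); last first.
  rewrite -subrX1 mulr0 -exprM mulnC exprM.
  have -> : w ^+ N = 1.
    rewrite cisX mulrC divfK ?pnatr_eq0 -?lt0n // /cis.
    by rewrite mulr_natl cos2pi sin2pi.
  by rewrite expr1n subrr.
(* By the double angle formula, a ratio equal to [1] would give a zero of the sine at [pi * d / N],
   strictly between [0] and [pi]. *)
rewrite subr_eq0; apply/eqP => /(congr1 (@complex.Re R)).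
rewrite cisX /=.
set a := d%:R * _.
have -> : a = (a / 2) *+ 2 by rewrite -mulr_natr divfK.
rewrite cos_mulr2n -[X in _ = X]/(1 : R) => h.
have : cos (a / 2) ^+ 2 = 1 by lra.
have NR : 0 < N%:R :> R by rewrite ltr0n.
have -> : a / 2 = d%:R / N%:R * pi.
  by rewrite /a; field; rewrite pnatr_eq0 -lt0n.
move=> h2.
have : sin (d%:R / N%:R * pi) ^+ 2 = 0 :> R by rewrite sin2cos2 h2 subrr.
move/eqP; rewrite expf_eq0 /=; apply/negP; rewrite gt_eqF //.
apply: sin_gt0_pi; rewrite mulr_gt0 ?divr_gt0 ?ltr0n ?pi_gt0 //=.
by rewrite gtr_pMl ?pi_gt0 // ltr_pdivrMr // mul1r ltr_nat.
Qed.

End Cis.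

(** * Ergodic sums of the rotated operators [z T] *)

Section UniformErgodic.
Variables (R : realType) (H : completeNormedModType R[i]).
Variable ip : {dot H for (@Num.conj R[i])}.
Hypothesis ip_norm : forall x : H, `|x| ^+ 2 = ip x x.
Variables (T : {linear H -> H}) (K : R).
Hypothesis K1 : 1 <= K.
Hypothesis TK : forall n v, rnorm (iter n T v) <= K * rnorm v.
Hypothesis noeig : forall (z : R[i]) (v : H), cabs z = 1 -> T v = z *: v -> v = 0.

Definition twsum (z : R[i]) N (x : H) : H :=
  \sum_(i < N) z ^+ i *: iter i T x.

Lemma iter_scale (z : R[i]) n v : iter n (z \*: T) v = z ^+ n *: iter n T v.
Proof.
elim: n => [|n IH] /=; first by rewrite scale1r.
by rewrite IH linearZ /= scalerA -exprS.
Qed.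

Lemma twsumE z N x : twsum z N x = \sum_(i < N) iter i (z \*: T) x.
Proof. by apply: eq_bigr => i _; rewrite iter_scale. Qed.

Lemma iter_scale_bound z : cabs z = 1 ->
  forall n v, rnorm (iter n (z \*: T) v) <= K * rnorm v.
Proof. by move=> z1 n v; rewrite iter_scale rnormZ cabsX z1 expr1n mul1r. Qed.

(** A nonzero fixed vector of [z T] would be an eigenvector of [T] for [z^-1], which again lies on
    the circle. *)
Lemma twsum_ergodic z x : cabs z = 1 ->
  forall e : R, 0 < e -> exists N0, forall N, (N0 <= N)%N ->
    rnorm (twsum z N x) <= e * N%:R.
Proof.
move=> z1 e e0.
have [|N0 NP] := mean_ergodic ip_norm K1 (iter_scale_bound z1) x _ e0.
  move=> v /= zv.
  have z0 : z != 0.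
    by apply/eqP => z0; move: z1; rewrite z0 /cabs normr0 => /eqP; rewrite eq_sym oner_eq0.
  apply: (noeig (z := z^-1)); last by rewrite -[in RHS]zv scalerA mulVf ?scale1r.
  have := cabsM z^-1 z; rewrite mulVf // z1 mulr1 => <-.
  by rewrite /cabs normr1.
by exists N0 => N /NP; rewrite twsumE.
Qed.

(** Passage from one length [L] to all lengths [M], with an error depending on [S] only through [K].
    The sum [B] over [i < M] is compared with its shifts [S^h B], [h < L]: telescoping twice,
    [S^h B - B] is the sum of [S^i (S^M x - x)] over [i < h]. *)
Lemma sum_iter_long (S : {linear H -> H})
    (SK : forall n v, rnorm (iter n S v) <= K * rnorm v) (L M : nat) x :
  L%:R * rnorm (\sum_(i < M) iter i S x) <=
    M%:R * (K * rnorm (\sum_(i < L) iter i S x)) + L%:R * (L%:R * (2 * K * (K * rnorm x))).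
Proof.
set B := \sum_(i < M) iter i S x.
have K0 : 0 <= K := le_trans ler01 K1.
have shift h : rnorm (iter h S B - B) <= h%:R * (2 * K * (K * rnorm x)).
  rewrite -sum_iter_coboundary.
  have -> : S B - B = iter M S x - x.
    rewrite -(sum_iter_coboundary S M) /B linear_sum -sumrB.
    by apply: eq_bigr => i _; rewrite iter_linD iter_linN -iterSr.
  apply: le_trans (sum_iter_bound SK _ _) _.
  rewrite ler_wpM2l ?ler0n // -mulrA mulrCA ler_wpM2l //.
  apply: le_trans (rnormB _ _) _; rewrite mulr_natl mulr2n lerD //.
  by rewrite ler_peMl ?rnorm_ge0.
have BL : \sum_(i < M) iter i S (\sum_(h < L) iter h S x) = \sum_(h < L) iter h S B.
  under eq_bigr do rewrite iter_lin_sum.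
  rewrite exchange_big /=; apply: eq_bigr => h _.
  by rewrite iter_lin_sum; apply: eq_bigr => i _; rewrite -!iterD addnC.
have := sum_iter_bound SK M (\sum_(h < L) iter h S x); rewrite BL => h1.
have -> : L%:R * rnorm B = rnorm (\sum_(h < L) B).
  by rewrite sumr_const card_ord rnormMn.
have -> : \sum_(h < L) B = \sum_(h < L) iter h S B - \sum_(h < L) (iter h S B - B).
  by rewrite -sumrB; apply: eq_bigr => h _; rewrite subKr.
apply: le_trans (rnormB _ _) _; apply: lerD => //.
apply: le_trans (rnorm_sum _ _ _) _.
apply: (@le_trans _ _ (\sum_(h < L) L%:R * (2 * K * (K * rnorm x)))); last first.
  by rewrite sumr_const card_ord -(mulr_natl (L%:R * _)) lexx.
apply: ler_sum => h _; apply: le_trans (shift h) _.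
rewrite ler_wpM2r ?ler_nat ?(ltnW (ltn_ord h)) //.
by rewrite !mulr_ge0 ?rnorm_ge0.
Qed.

Lemma twsum_lip z z' L x : cabs z = 1 -> cabs z' = 1 ->
  rnorm (twsum z L x - twsum z' L x) <= L%:R * (L%:R * cabs (z - z') * (K * rnorm x)).
Proof.
move=> z1 z'1; have K0 : 0 <= K := le_trans ler01 K1.
have dX n : cabs (z ^+ n - z' ^+ n) <= n%:R * cabs (z - z').
  have cabsD (a b : R[i]) : cabs (a + b) <= cabs a + cabs b.
    by rewrite -lecR rmorphD /= -!cabsE ler_normD.
  elim: n => [|n IH]; first by rewrite subrr /cabs normr0 mul0r.
  have -> : z ^+ n.+1 - z' ^+ n.+1 = z * (z ^+ n - z' ^+ n) + (z - z') * z' ^+ n.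
    by rewrite !exprS; ring.
  apply: le_trans (cabsD _ _) _.
  by rewrite !cabsM cabsX z1 z'1 expr1n mul1r mulr1 -natr1 mulrDl mul1r lerD2r.
rewrite -sumrB; apply: le_trans (rnorm_sum _ _ _) _.
rewrite -[X in X%:R * _](card_ord L) mulr_natl -sumr_const.
apply: ler_sum => i _; rewrite -scalerBl rnormZ.
apply: ler_pM => //; rewrite ?cabs_ge0 ?rnorm_ge0 //.
apply: le_trans (dX i) _.
by rewrite ler_wpM2r ?cabs_ge0 // ler_nat ltnW.
Qed.

(** Near each [t] one fixed length [L] works by continuity, and [sum_iter_long] then handles all
    large [N] at once; compactness of the segment makes the threshold global. *)
Lemma uniform_ergodic x (e : R) : 0 < e ->
  exists N0, forall N, (N0 <= N)%N -> forall t, 0 <= t <= 2 * pi ->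
    rnorm (twsum (cis t) N x) <= e * N%:R.
Proof.
move=> e0.
have K0 : 0 < K := lt_le_trans ltr01 K1.
have /compact_near_coveringP cov := @segment_compact R 0 (2 * pi).
have := cov nat \oo (fun N t => rnorm (twsum (cis t) N x) <= e * N%:R) _.
case=> [t _|N0 _ NP]; last first.
  by exists N0 => N N0N t t2; apply: (NP N N0N); rewrite /= in_itv.
have e40 : 0 < e / (4 * K) by rewrite divr_gt0 // mulr_gt0.
have [L0 L0P] := twsum_ergodic x (cabs_cis t) e40.
pose L := L0.+1; have := L0P L (leqnSn _); set tw := twsum _ _ _ => LP.
have LR : 0 < L%:R :> R by rewrite ltr0n.
(* For [s] this close to [t], the bound of [twsum_lip] costs at most another [e / (4 K)] per
   term. *)
pose d := (e / (4 * K)) / (L%:R * (K * rnorm x) + 1).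
have den0 : 0 < L%:R * (K * rnorm x) + 1.
  by rewrite ltr_wpDl // !mulr_ge0 ?ler0n ?rnorm_ge0 // ltW.
have d0 : 0 < d by rewrite divr_gt0.
have [N1 N1P] : exists N1 : nat, 4 * L%:R * (K * (K * rnorm x)) / e <= N1%:R.
  by eexists; exact/ltW/truncnS_gt.
exists ([set s | cabs (cis s - cis t) <= d], [set N | (N1 <= N)%N]).
  by split; [exact: cis_cvg|exact: nbhs_infty_ge].
move=> [s N] /= [sd N1N].
have h1 := twsum_lip L x (cabs_cis s) (cabs_cis t).
have h2 : L%:R * cabs (cis s - cis t) * (K * rnorm x) <= e / (4 * K).
  have : d * (L%:R * (K * rnorm x) + 1) = e / (4 * K) by rewrite divfK ?gt_eqF.
  have : cabs (cis s - cis t) * (L%:R * (K * rnorm x) + 1) <= d * (L%:R * (K * rnorm x) + 1).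
    by rewrite ler_pM2r.
  have := cabs_ge0 (cis s - cis t); lra.
have h3 : rnorm (twsum (cis s) L x) <= e / (2 * K) * L%:R.
  have -> : twsum (cis s) L x = (twsum (cis s) L x - tw) + tw by rewrite subrK.
  apply: le_trans (rnormD _ _) _.
  have : L%:R * (L%:R * cabs (cis s - cis t) * (K * rnorm x)) <= L%:R * (e / (4 * K)).
    by rewrite ler_pM2l.
  have -> : e / (2 * K) = 2 * (e / (4 * K)) by field; rewrite gt_eqF.
  lra.
have h4 := sum_iter_long (iter_scale_bound (cabs_cis s)) L N x.
rewrite -!twsumE in h4.
rewrite -(ler_pM2l LR); apply: le_trans h4 _.
have NR : N1%:R <= N%:R :> R by rewrite ler_nat.
move: N1P; rewrite ler_pdivrMr // => N1P.
have h5 : N%:R * (K * rnorm (twsum (cis s) L x)) <= N%:R * (e / 2 * L%:R).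
  rewrite ler_wpM2l ?ler0n //.
  have -> : e / 2 * L%:R = K * (e / (2 * K) * L%:R) by field; rewrite gt_eqF.
  by rewrite ler_pM2l.
have h6 : L%:R * (4 * L%:R * (K * (K * rnorm x))) <= L%:R * (N%:R * e).
  rewrite ler_pM2l //; apply: le_trans N1P _; by rewrite ler_pM2r.
lra.
Qed.

End UniformErgodic.

(** * Exponents growing with constant speed *)

Lemma sum_ord_tail (V : nmodType) (F : nat -> V) (L N : nat) : (L <= N)%N ->
  \sum_(n < N) F n = \sum_(n < N - L) F n + \sum_(j < L) F (N - L + j)%N.
Proof. by move=> LN; rewrite -[in LHS](subnK LN) big_split_ord. Qed.

Section Parseval.
Variables (R : realType) (H : completeNormedModType R[i]).
Variable ip : {dot H for (@Num.conj R[i])}.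
Hypothesis ip_norm : forall x : H, `|x| ^+ 2 = ip x x.

Definition root1 N : R[i] := cis (2 * pi / N%:R).

Lemma parseval N (Y : nat -> H) :
  \sum_(k < N) rnorm (\sum_(s < N) root1 N ^+ (k * s) *: Y s) ^+ 2
    = N%:R * \sum_(s < N) rnorm (Y s) ^+ 2.
Proof.
under eq_bigr => k _.
  rewrite -(ripvv ip_norm) rip_suml.
  under eq_bigr do rewrite rip_sumr.
  over.
rewrite exchange_big /= mulr_sumr; apply: eq_bigr => s _.
rewrite exchange_big /= (bigD1 s) //= [X in _ + X]big1 ?addr0 => [|t ts].
  under eq_bigr do rewrite ripZ.
  rewrite -raddf_sum -mulr_suml cis_sum0 // eqxx -(ripvv ip_norm) /rip.
  by rewrite !mulr_natl; apply: (raddfMn (@complex.Re R)).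
under eq_bigr do rewrite ripZ.
rewrite -raddf_sum -mulr_suml cis_sum0 //.
have -> : (s == t :> nat) = false by rewrite eq_sym; apply/negbTE.
by rewrite mul0r.
Qed.

Variables (T : {linear H -> H}) (K : R).
Hypothesis K1 : 1 <= K.
Hypothesis TK : forall n v, rnorm (iter n T v) <= K * rnorm v.
Hypothesis noeig : forall (z : R[i]) (v : H), cabs z = 1 -> T v = z *: v -> v = 0.

(** [N0] is chosen before [c]; this uniformity later allows coefficients to be truncated, regrouped
    or made to depend on [N]. *)
Definition null (a : nat -> nat) (x : H) :=
  forall e : R, 0 < e -> exists N0, forall N, (N0 <= N)%N ->
    forall c : nat -> R, (forall n, `|c n| <= 1) ->
    rnorm (\sum_(n < N) (c n)%:C *: iter (a n) T x) <= e * N%:R.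

(* The vectors on the left are the convolution of [c] with the orbit of [x]
   truncated to length [M], so their discrete Fourier transform is the product
   of that of [c] with the twisted sum [twsum]. *)
Lemma conv_bound L M (c : nat -> R) x (e : R) : (0 < L)%N ->
  (forall n, `|c n| <= 1) ->
  (forall t, 0 <= t <= 2 * pi -> rnorm (twsum T (cis t) M x) <= e * M%:R) ->
  \sum_(s < M + L) rnorm (\sum_(h < L) \sum_(i < M | (h + i == s)%N)
     (c h)%:C *: iter i T x) ^+ 2 <= L%:R * (e * M%:R) ^+ 2.
Proof.
move=> L0 c1 eM; set N := (M + L)%N.
have N0 : (0 < N)%N by rewrite addn_gt0 L0 orbT.
have NR : 0 < N%:R :> R by rewrite ltr0n.
rewrite -(ler_pM2l NR).
rewrite -(parseval N (fun s => \sum_(h < L) \sum_(i < M | (h + i == s)%N) (c h)%:C *: iter i T x)).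
pose chat k := \sum_(h < L) root1 N ^+ (k * h) * (c h)%:C.
have hat k : \sum_(s < N) root1 N ^+ (k * s) *:
    (\sum_(h < L) \sum_(i < M | (h + i == s)%N) (c h)%:C *: iter i T x) =
    chat k *: twsum T (root1 N ^+ k) M x.
  rewrite scaler_suml; under eq_bigr do rewrite scaler_sumr.
  rewrite exchange_big /=; apply: eq_bigr => h _.
  rewrite scaler_sumr.
  under eq_bigr do rewrite scaler_sumr.
  rewrite (exchange_big_dep xpredT) //=; apply: eq_bigr => i _.
  have hiN : (h + i < N)%N by rewrite /N addnC -addSn leq_add // ltnW.
  rewrite (big_pred1 (Ordinal hiN)) => [|s]; last by rewrite /= -val_eqE eq_sym.
  by rewrite /= scalerA scalerA -!exprM mulnDr exprD mulrAC.
(* The scalar Parseval bound for [c] is read off the vector-valued one applied to the multiples of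
   [x] by [c h]; dividing by [|x|^2] requires [x != 0], hence the case distinction below. *)
have chatP : \sum_(k < N) cabs (chat k) ^+ 2 * rnorm x ^+ 2 <= N%:R * (L%:R * rnorm x ^+ 2).
  pose Y h : H := if (h < L)%N then (c h)%:C *: x else 0.
  have LN : (L <= N)%N by exact: leq_addl.
  have widen (V : nmodType) (F : nat -> V) :
      \sum_(s < N) (if (s < L)%N then F s else 0) = \sum_(h < L) F h.
    by rewrite -big_mkcond /= -big_ord_widen.
  have hatY k : \sum_(s < N) root1 N ^+ (k * s) *: Y s = chat k *: x.
    rewrite scaler_suml -(widen _ (fun h => (root1 N ^+ (k * h) * (c h)%:C) *: x)).
    apply: eq_bigr => s _.
    by rewrite /Y; case: ifP => _; rewrite ?scaler0 // scalerA.
  have -> : \sum_(k < N) cabs (chat k) ^+ 2 * rnorm x ^+ 2 =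
      \sum_(k < N) rnorm (\sum_(s < N) root1 N ^+ (k * s) *: Y s) ^+ 2.
    by apply: eq_bigr => k _; rewrite hatY rnormZ exprMn.
  rewrite parseval ler_pM2l //.
  have -> : \sum_(s < N) rnorm (Y s) ^+ 2 = \sum_(h < L) (c h) ^+ 2 * rnorm x ^+ 2.
    rewrite -(widen _ (fun h => c h ^+ 2 * rnorm x ^+ 2)).
    apply: eq_bigr => s _; rewrite /Y; case: ifP => _.
      by rewrite rnormZ cabs_real exprMn real_normK ?num_real.
    by rewrite rnorm0 expr0n.
  rewrite mulr_natl -[X in _ *+ X](card_ord L) -sumr_const; apply: ler_sum => h _.
  by rewrite ler_piMl ?sqr_ge0 // -real_normK ?num_real // expr_le1.
have [x0|x0] := eqVneq x 0.
  rewrite big1; first by rewrite mulr_ge0 // mulr_ge0 // sqr_ge0.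
  move=> k _.
  rewrite hat /twsum big1 ?scaler0 ?rnorm0 ?expr0n //.
  by move=> i _; rewrite x0 iter_lin0 scaler0.
have x2 : 0 < rnorm x ^+ 2.
  rewrite exprn_gt0 // lt_def rnorm_ge0 andbT.
  by apply: contra_neq x0 => /rnorm_eq0.
have chat2 : \sum_(k < N) cabs (chat k) ^+ 2 <= N%:R * L%:R.
  by rewrite -(ler_pM2r x2) mulr_suml -mulrA.
apply: (@le_trans _ _ (\sum_(k < N) cabs (chat k) ^+ 2 * (e * M%:R) ^+ 2)).
  apply: ler_sum => k _; rewrite hat rnormZ exprMn ler_wpM2l ?sqr_ge0 //.
  have h : rnorm (twsum T (root1 N ^+ k) M x) <= e * M%:R.
    rewrite /root1 cisX; apply: eM; rewrite mulr_ge0 ?divr_ge0 ?mulr_ge0 ?pi_ge0 //=.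
    by rewrite mulrCA ler_piMr ?mulr_ge0 ?pi_ge0 // ler_pdivrMr // mul1r ler_nat ltnW.
  by rewrite ler_sqr ?nnegrE ?rnorm_ge0 //; apply: le_trans h; exact: rnorm_ge0.
by rewrite -mulr_suml [leRHS]mulrA ler_wpM2r ?sqr_ge0.
Qed.

Lemma null_id x : null id x.
Proof.
move=> e e0.
have K0 : 0 < K := lt_le_trans ltr01 K1.
have e40 : 0 < e / (4 * K) by rewrite divr_gt0 // mulr_gt0.
have [N0 N0P] := uniform_ergodic ip_norm K1 TK noeig x e40.
pose L := N0.+1; have L0 : (0 < L)%N by [].
have LR : 0 < L%:R :> R by rewrite ltr0n.
(* With [M = 2 L], the mean square bound excludes that all [L] positions [s] from [L] to [2 L - 1]
   carry a large vector. At these positions every [i = s - h] is in range, so the convolution there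
   is not truncated. *)
have window (c : nat -> R) : (forall n, `|c n| <= 1) ->
    exists2 s, (L <= s)%N && (s < 2 * L)%N &
    rnorm (\sum_(h < L) (c h)%:C *: iter (s - h) T x) <= e / (2 * K) * L%:R.
  move=> c1.
  have N0L : (N0 <= 2 * L)%N by rewrite /L; lia.
  pose G s := rnorm (\sum_(h < L) \sum_(i < 2 * L | (h + i == s)%N)
    (c h)%:C *: iter i T x) ^+ 2.
  have hF : \sum_(s < 2 * L + L) G s <= L%:R * (e / (4 * K) * (2 * L)%:R) ^+ 2.
    exact: (conv_bound L0 c1 (N0P _ N0L)).
  apply: contrapT => hn.
  have FE s : (L <= s)%N -> (s < 2 * L)%N ->
      \sum_(h < L) \sum_(i < 2 * L | (h + i == s)%N) (c h)%:C *: iter i T x =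
      \sum_(h < L) (c h)%:C *: iter (s - h) T x.
    move=> Ls sL; apply: eq_bigr => h _.
    have hs : (s - h < 2 * L)%N by rewrite (leq_ltn_trans (leq_subr _ _)).
    rewrite (big_pred1 (Ordinal hs)) // => i /=.
    rewrite -val_eqE /=; have := ltn_ord h; lia.
  have big_s (j : 'I_L) : (e / (2 * K) * L%:R) ^+ 2 < G (L + j)%N.
    have jL := ltn_ord j.
    have Ls : (L <= L + j)%N by rewrite leq_addr.
    have sL : (L + j < 2 * L)%N by lia.
    rewrite /G FE //.
    have nn : 0 <= e / (2 * K) * L%:R.
      by apply/ltW; rewrite mulr_gt0 // divr_gt0 // mulr_gt0.
    rewrite ltr_sqr ?nnegrE ?rnorm_ge0 //.
    rewrite ltNge; apply/negP => hle; apply: hn.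
    by exists (L + j)%N => //; rewrite Ls sL.
  have : \sum_(j < L) (e / (2 * K) * L%:R) ^+ 2 < L%:R * (e / (4 * K) * (2 * L)%:R) ^+ 2.
    apply: lt_le_trans hF.
    apply: (@lt_le_trans _ _ (\sum_(j < L) G (L + j)%N)).
      apply: ltr_sum => [|j _]; last exact: big_s.
      by apply/hasP; exists (Ordinal L0); rewrite ?mem_index_enum.
    rewrite (_ : (2 * L + L = L + (L + L))%N); last by lia.
    rewrite !big_split_ord /=.
    by rewrite addrCA lerDl addr_ge0 // sumr_ge0 // => i _; rewrite sqr_ge0.
  rewrite sumr_const card_ord -(mulr_natl (_ ^+ 2) L).
  have -> : e / (4 * K) * (2 * L)%:R = e / (2 * K) * L%:R.
    by rewrite natrM; field; rewrite gt_eqF.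
  by rewrite ltxx.
(* Reversing the block and writing the exponent [N - h - 1] as [(N - s - 1) + (s - h)] exhibits it
   as the image of a small window under a power of [T]; [3 L <= N] leaves room for [s < 2 L]. *)
have block (c : nat -> R) N : (forall n, `|c n| <= 1) -> (3 * L <= N)%N ->
   rnorm (\sum_(j < L) (c (N - L + j)%N)%:C *: iter (N - L + j) T x) <= e / 2 * L%:R.
  move=> c1 LN.
  have [s /andP[Ls sL] sP] := window (fun h => c (N - h.+1)%N) (fun h => c1 _).
  rewrite (reindex_inj rev_ord_inj) /=.
  have -> : \sum_(j < L) (c (N - L + (L - j.+1))%N)%:C *: iter (N - L + (L - j.+1)) T x
     = iter (N - s.+1) T (\sum_(h < L) (c (N - h.+1)%N)%:C *: iter (s - h) T x).
    rewrite iter_lin_sum; apply: eq_bigr => h _.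
    have hL := ltn_ord h.
    rewrite iter_linZ -iterD.
    by congr ((c _)%:C *: iter _ T x); lia.
  apply: le_trans (TK _ _) _.
  have -> : e / 2 * L%:R = K * (e / (2 * K) * L%:R) by field; rewrite gt_eqF.
  by rewrite ler_pM2l.
have Cb0 : 0 <= 3 * L%:R * (K * rnorm x) by rewrite !mulr_ge0 ?rnorm_ge0 ?ler0n ?ltW.
(* Blocks of length [L] are split off at the end until fewer than [3 L] terms remain. *)
have total (c : nat -> R) : (forall n, `|c n| <= 1) -> forall N,
   rnorm (\sum_(n < N) (c n)%:C *: iter n T x) <= 3 * L%:R * (K * rnorm x) + e / 2 * N%:R.
  move=> c1; elim/ltn_ind => N IH.
  have [LN|NL] := leqP (3 * L) N.
    have NL : (N = (N - L) + L)%N by lia.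
    have LN' : (L <= N)%N by lia.
    rewrite (sum_ord_tail (fun n => (c n)%:C *: iter n T x) LN'); apply: le_trans (rnormD _ _) _.
    have := IH (N - L)%N ltac:(lia); have := block c N c1 LN.
    have : N%:R = (N - L)%:R + L%:R :> R by rewrite -natrD -NL.
    by move=> ->; lra.
  apply: le_trans (rnorm_sum _ _ _) _.
  apply: (@le_trans _ _ (\sum_(n < N) K * rnorm x)).
    by apply: ler_sum => n _; apply: le_trans (rnormZ_le _ (c1 n)) _.
  rewrite sumr_const card_ord -(mulr_natl (K * _)).
  have : N%:R * (K * rnorm x) <= (3 * L)%:R * (K * rnorm x).
    apply: ler_wpM2r; last by rewrite ler_nat ltnW.
    by rewrite mulr_ge0 ?rnorm_ge0 // ltW.
  have : 0 <= e / 2 * N%:R by rewrite mulr_ge0 ?ler0n // divr_ge0 // ltW.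
  by rewrite natrM; lra.
have [N1 N1P] : exists N1 : nat, 6 * L%:R * (K * rnorm x) / e <= N1%:R.
  by eexists; exact/ltW/truncnS_gt.
exists N1 => N N1N c c1; apply: le_trans (total c c1 N) _.
have NR : N1%:R <= N%:R :> R by rewrite ler_nat.
move: N1P; rewrite ler_pdivrMr // => N1P.
have : N1%:R * e <= N%:R * e by rewrite ler_pM2r.
lra.
Qed.

End Parseval.

(** * Sequences of class P_1 *)

(** Each unit shift drops one term and adds another. The norm is abstract because the bound serves
    both for reals and for vectors of [H]. *)
Lemma sum_shift_bound (R : realType) (V : zmodType) (norm : V -> R)
    (g : nat -> V) (k : R) (J e : nat) :
  norm 0 = 0 -> (forall x y, norm (x + y) <= norm x + norm y) ->
  (forall x, norm (- x) = norm x) -> (forall n, norm (g n) <= k) ->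
  norm (\sum_(j < J) g (e + j)%N - \sum_(j < J) g j) <= 2 * e%:R * k.
Proof.
move=> norm0 normD normN gk; elim: e => [|e IH].
  by rewrite subrr norm0 mulr0 mul0r.
have -> : \sum_(j < J) g (e.+1 + j)%N = \sum_(j < J) g (e + j)%N + (g (e + J)%N - g e).
  have h : \sum_(j < J.+1) g (e + j)%N = g e + \sum_(j < J) g (e + bump 0 j)%N.
    by rewrite big_ord_recl addn0.
  rewrite big_ord_recr /= in h; rewrite addrA h [g e + _]addrC addrK.
  by apply: eq_bigr => j _; rewrite /bump /= addnA addn1.
rewrite addrAC; apply: le_trans (normD _ _) _.
have := normD (g (e + J)%N) (- g e); have := gk (e + J)%N; have := gk e.
rewrite normN -natr1; lra.
Qed.

Lemma sum_if_prefix (R : realType) (C : R) (m N : nat) : 0 <= C ->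
  \sum_(n < N) (if (n < m)%N then C else 0) <= m%:R * C.
Proof.
move=> C0; have [mN|Nm] := leqP m N.
  by rewrite -big_mkcond /= -(big_ord_widen N (fun=> C) mN) sumr_const card_ord
    -(mulr_natl C) lexx.
apply: (@le_trans _ _ (\sum_(n < N) C)).
  by apply: ler_sum => n _; case: ifP.
rewrite sumr_const card_ord -(mulr_natl C).
by rewrite ler_wpM2r // ler_nat ltnW.
Qed.

(** If [m] is the first and [N] the last index satisfying [P], there are at most [N - m + 1] such
    indices. *)
Lemma count_spread (R : realType) (P : pred nat) (D : R) (N : nat) : 0 <= D ->
  (forall n n', P n -> P n' -> (n <= n')%N -> n'%:R - n%:R <= D) ->
  \sum_(n < N | P n) (1 : R) <= D + 1.
Proof.
move=> D0 spread; elim: N => [|N IH]; first by rewrite big_ord0 addr_ge0.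
rewrite big_mkcond big_ord_recr -big_mkcond /=.
case: ifP => [PN|_]; last by rewrite addr0.
have exP : exists n, P n by exists N.
have := ex_minnP exP; case=> m Pm mmin.
have mN := mmin _ PN.
have count M : \sum_(n < M | P n) (1 : R) <= (M - m)%:R.
  elim: M => [|M IHM]; first by rewrite big_ord0.
  rewrite big_mkcond big_ord_recr -big_mkcond /=.
  case: ifP => [/mmin mM|_].
    by rewrite subSn // -natr1 lerD2r.
  by rewrite addr0; apply: le_trans IHM _; rewrite ler_nat leq_sub2r.
have := count N; rewrite natrB //; have := spread _ _ Pm PN mN; lra.
Qed.

Section Sequences.
Variable R : realType.
Implicit Types u : nat -> R.

(** [Num.truncn] is the integer part on nonnegative reals and [0] on negative ones. *)
Definition floors u n : nat := Num.truncn (u n).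
Definition diff u (h : nat) n : R := u (n + h)%N - u n.

(* Discrete integrated forms of [f <= C t f'] and of [f' s <= C f' t], [s >= t];
   the second inequality also contains [t f' <= C f]. *)
Definition base u := exists C n0, [/\ 0 < C,
  forall n, (n0 <= n)%N -> 0 < u n,
  forall n n' N, (n0 <= n)%N -> (n <= n')%N -> (n' <= N)%N ->
    (n'%:R - n%:R) * u N <= C * N%:R * (u n' - u n) &
  forall n n', (n0 <= n)%N -> (n <= n')%N ->
    n%:R * (u n' - u n) <= C * (n'%:R - n%:R) * u n].

(** The upper growth bound of [base] over one doubling only; in this form it passes from [diff u 1]
    to [u] when [u] tends to infinity. *)
Definition reg u := exists C n0, [/\ 0 < C,
  forall n, (n0 <= n)%N -> 0 < u n &
  forall n n', (n0 <= n)%N -> (n <= n')%N -> (n' <= 2 * n)%N ->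
    n%:R * (u n' - u n) <= C * (n'%:R - n%:R) * u n].

Definition to_infty u := forall A : R, exists n0, forall n, (n0 <= n)%N -> A <= u n.

Lemma base_reg u : base u -> reg u.
Proof.
move=> [C [n0 [C0 pos _ up]]]; exists C, n0; split=> // n n' nn nn' _.
exact: up.
Qed.

Lemma base_nondec u : base u -> exists n0, forall n n',
  (n0 <= n)%N -> (n <= n')%N -> u n <= u n'.
Proof.
move=> [C [n0 [C0 pos low _]]]; exists n0.+1 => n n' nn nn'.
have h := low n n' n' (ltnW nn) nn' (leqnn _).
have n'0 : 0 < C * n'%:R.
  by rewrite mulr_gt0 // ltr0n (leq_trans _ nn') // (leq_trans _ nn).
rewrite -subr_ge0 -(pmulr_rge0 _ n'0); apply: le_trans h.
rewrite mulr_ge0 ?subr_ge0 ?ler_nat //.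
by apply/ltW/pos; rewrite (leq_trans _ nn') // ltnW.
Qed.

(** With [n' = N = 2 n], the lower growth bound shows that each doubling of the index adds at least
    the fixed amount [u m / (2 C)]. *)
Lemma base_infty u : base u -> to_infty u.
Proof.
move=> bu; have [n1 mono] := base_nondec bu.
have [C [n0 [C0 pos low _]]] := bu.
pose m := (maxn n0 n1).+1.
have um : 0 < u m by apply: pos; rewrite /m leqW // leq_maxl.
have growth k : u m + k%:R * (u m / (2 * C)) <= u (2 ^ k * m)%N.
  elim: k => [|k IH]; first by rewrite mul0r addr0 expn0 mul1n.
  set v := (2 ^ k * m)%N in IH *.
  have mv : (m <= v)%N by rewrite leq_pmull // expn_gt0.
  have n0v : (n0 <= v)%N by apply: leq_trans mv; rewrite /m leqW // leq_maxl.
  have n1v : (n1 <= v)%N by apply: leq_trans mv; rewrite /m leqW // leq_maxr.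
  have -> : (2 ^ k.+1 * m = 2 * v)%N by rewrite expnS mulnA.
  have vv : (v <= 2 * v)%N by rewrite leq_pmull.
  have := low v (2 * v)%N (2 * v)%N n0v vv (leqnn _).
  have vR : 0 < v%:R :> R by rewrite ltr0n (leq_trans _ mv).
  have mono2 := mono _ _ n1v vv.
  have umv : u m <= u v by apply: mono => //; rewrite /m leqW // leq_maxr.
  rewrite natrM => h.
  have h2 : u (2 * v)%N <= (2 * C) * (u (2 * v)%N - u v).
    rewrite -(ler_pM2l vR); lra.
  have h3 : u m / (2 * C) <= u (2 * v)%N - u v.
    by rewrite ler_pdivrMr ?mulr_gt0 // mulrC; lra.
  rewrite -natr1; lra.
move=> A.
have d0 : 0 < u m / (2 * C) by rewrite divr_gt0 // mulr_gt0.
pose k := (Num.truncn (A / (u m / (2 * C)))).+1.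
exists (2 ^ k * m)%N => n kn.
have : A <= k%:R * (u m / (2 * C)).
  by rewrite -ler_pdivrMr //; exact/ltW/truncnS_gt.
have := growth k; have : u (2 ^ k * m)%N <= u n.
  apply: mono => //; apply: (@leq_trans m); last by rewrite leq_pmull // expn_gt0.
  by rewrite /m leqW // leq_maxr.
lra.
Qed.

End Sequences.

(** * Stability of null averages, and the base case *)

Section Null.
Variables (R : realType) (H : completeNormedModType R[i]).
Variable ip : {dot H for (@Num.conj R[i])}.
Hypothesis ip_norm : forall x : H, `|x| ^+ 2 = ip x x.
Variables (T : {linear H -> H}) (K : R).
Hypothesis K1 : 1 <= K.
Hypothesis TK : forall n v, rnorm (iter n T v) <= K * rnorm v.
Hypothesis noeig : forall (z : R[i]) (v : H), cabs z = 1 -> T v = z *: v -> v = 0.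

Let K0 : 0 < K. Proof. exact: lt_le_trans ltr01 K1. Qed.

Lemma prefix_bound (a : nat -> nat) (c : nat -> R) x m N :
  (forall n, `|c n| <= 1) -> (forall n, (m <= n)%N -> c n = 0) ->
  rnorm (\sum_(n < N) (c n)%:C *: iter (a n) T x) <= m%:R * (K * rnorm x).
Proof.
move=> c1 c0; apply: le_trans (rnorm_sum _ _ _) _.
have Kx : 0 <= K * rnorm x by rewrite mulr_ge0 ?rnorm_ge0 // ltW.
apply: le_trans (sum_if_prefix m N Kx); apply: ler_sum => n _.
case: ifP => [_|/negbT]; first exact: le_trans (rnormZ_le _ (c1 n)) _.
by rewrite -leqNgt => /c0 ->; rewrite scale0r rnorm0.
Qed.

(** Where [a' n = (a n).+1], the exponent [a n] acts on [T x] instead, so the hypothesis is needed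
    for all vectors. The coefficients are restricted to each of the two index sets. *)
Lemma null_floor (a a' : nat -> nat) n0 :
  (forall n, (n0 <= n)%N -> a' n = a n \/ a' n = (a n).+1) ->
  (forall x, null T a x) -> forall x, null T a' x.
Proof.
move=> aa' na x e e0.
have e30 : 0 < e / 3 by rewrite divr_gt0.
have [N1 N1P] := na x _ e30; have [N2 N2P] := na (T x) _ e30.
have [N3 N3P] : exists N3 : nat, n0%:R * (K * rnorm x) / (e / 3) <= N3%:R.
  by eexists; exact/ltW/truncnS_gt.
exists (maxn N1 (maxn N2 N3)) => N; rewrite !geq_max => /and3P[NN1 NN2 NN3] c c1.
pose c1' n := if (n0 <= n)%N && (a' n == a n) then c n else 0.
pose c2' n := if (n0 <= n)%N && (a' n != a n) then c n else 0.
pose c3' n := if (n < n0)%N then c n else 0.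
have bd (b : bool) n : `|if b then c n else 0| <= 1.
  by case: b => //; rewrite normr0.
have -> : \sum_(n < N) (c n)%:C *: iter (a' n) T x =
   \sum_(n < N) (c1' n)%:C *: iter (a n) T x +
   \sum_(n < N) (c2' n)%:C *: iter (a n) T (T x) +
   \sum_(n < N) (c3' n)%:C *: iter (a' n) T x.
  rewrite -!big_split /=; apply: eq_bigr => n _; rewrite /c1' /c2' /c3'.
  case: (leqP n0 n) => [/aa'|_] /=; last by rewrite !scale0r !add0r.
  have [-> _|ne] := eqVneq (a' n) (a n); first by rewrite !scale0r !addr0.
  by case=> [/eqP|->]; [rewrite (negbTE ne)|rewrite !scale0r add0r addr0 -iterSr].
have h1 := N1P N NN1 c1' (fun n => bd _ n); have h2 := N2P N NN2 c2' (fun n => bd _ n).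
have h3 : rnorm (\sum_(n < N) (c3' n)%:C *: iter (a' n) T x) <= n0%:R * (K * rnorm x).
  apply: prefix_bound => [n|n nn]; first exact: bd.
  by rewrite /c3' ltnNge nn.
have NR : N3%:R <= N%:R :> R by rewrite ler_nat.
move: N3P; rewrite ler_pdivrMr // => N3P.
have h4 : N3%:R * (e / 3) <= N%:R * (e / 3) by rewrite ler_pM2r.
apply: le_trans (rnormD _ _) _; have := rnormD (\sum_(n < N) (c1' n)%:C *: iter (a n) T x)
  (\sum_(n < N) (c2' n)%:C *: iter (a n) T (T x)).
lra.
Qed.

Lemma null_base (u : nat -> R) x : base u -> null T (floors u) x.
Proof.
move=> bu; have inf := base_infty bu; have [n1 mono] := base_nondec bu.
have [C [n2 [C0 pos low up]]] := bu.
pose n0 := (maxn n1 n2).+1.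
have n10 : (n1 <= n0)%N by rewrite /n0 leqW // leq_maxl.
have n20 : (n2 <= n0)%N by rewrite /n0 leqW // leq_maxr.
have un0 : 0 < u n0 by exact: pos.
(* Slope of a linear upper bound for [u], which finally turns the term [u N] into a multiple of
   [N]. *)
pose C2 := (1 + C) * u n0.
have C20 : 0 < C2 by rewrite mulr_gt0 // addr_gt0.
have u_lin N : (n0 <= N)%N -> u N <= C2 * N%:R.
  move=> nN; have := up n0 N n20 nN.
  have n0R : 1 <= n0%:R :> R by rewrite ler1n.
  have NR : n0%:R <= N%:R :> R by rewrite ler_nat.
  set d := u N - u n0 => h.
  have d0 : 0 <= d by rewrite subr_ge0 mono.
  have h1 : d <= n0%:R * d by rewrite ler_peMl.
  have h2 : C * (N%:R - n0%:R) * u n0 <= C * N%:R * u n0.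
    by rewrite ler_pM2r // ler_pM2l // lerBlDr lerDl ler0n.
  have h3 : u n0 <= N%:R * u n0 by rewrite ler_peMl ?(le_trans n0R) // ltW.
  have uNd : u N = d + u n0 by rewrite /d subrK.
  rewrite uNd /C2; lra.
move=> e e0.
pose e1 := e / (4 * (C + C2)).
have den0 : 0 < 4 * (C + C2) by rewrite mulr_gt0 // addr_gt0.
have e10 : 0 < e1 by rewrite divr_gt0.
have [Q0 Q0P] := null_id ip_norm K1 TK noeig x e10.
have [N1 N1P] := inf (Q0%:R + 1).
have [N2 N2P] : exists N2 : nat, n0%:R * (K * rnorm x) / (e / 2) <= N2%:R.
  by eexists; exact/ltW/truncnS_gt.
exists (maxn n0 (maxn N1 N2)) => N; rewrite !geq_max => /and3P[Nn0 NN1 NN2] c c1.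
pose c' n := if (n0 <= n)%N then c n else 0.
pose c'' n := if (n0 <= n)%N then 0 else c n.
have c'1 n : `|c' n| <= 1 by rewrite /c'; case: ifP => // _; rewrite normr0.
have -> : \sum_(n < N) (c n)%:C *: iter (floors u n) T x =
  \sum_(n < N) (c' n)%:C *: iter (floors u n) T x +
  \sum_(n < N) (c'' n)%:C *: iter (floors u n) T x.
  rewrite -big_split /=; apply: eq_bigr => n _; rewrite /c' /c''.
  by case: ifP => _; rewrite scale0r ?addr0 ?add0r.
have h2 : rnorm (\sum_(n < N) (c'' n)%:C *: iter (floors u n) T x) <= n0%:R * (K * rnorm x).
  apply: prefix_bound => [n|n nn]; last by rewrite /c'' nn.
  by rewrite /c''; case: ifP => // _; rewrite normr0.
pose Q := (floors u N).+1.
have uN1 : Q0%:R + 1 <= u N by exact: N1P.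
have uN0 : 0 < u N by apply: pos; exact: leq_trans Nn0.
have QuN : Q%:R <= 2 * u N.
  have /andP[h _] := truncn_itv (ltW uN0).
  have : (0 : R) <= Q0%:R by [].
  by rewrite /Q -natr1 /floors; lra.
have Q0Q : (Q0 <= Q)%N.
  rewrite -(ler_nat R); apply: le_trans (ltW (truncnS_gt (u N))).
  lra.
have floors_mono n : (n0 <= n)%N -> (n <= N)%N -> (floors u n < Q)%N.
  move=> nn nN; rewrite ltnS; apply: le_truncn; apply: mono => //.
  exact: leq_trans nn.
(* All indices with the same exponent [k] are merged into one coefficient of size at most [D + 1];
   after division by [D + 1], [null_id] applies with length [Q]. *)
pose CC k : R := \sum_(n < N | floors u n == k) c' n.
have sumE : \sum_(n < N) (c' n)%:C *: iter (floors u n) T x =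
    \sum_(k < Q) (CC k)%:C *: iter k T x.
  under [RHS]eq_bigr do rewrite /CC rmorph_sum scaler_suml.
  rewrite (exchange_big_dep xpredT) //=; apply: eq_bigr => n _.
  rewrite /c'; case: ifP => [nn|_]; last first.
    by rewrite scale0r big1 // => k _; rewrite scale0r.
  have fQ := floors_mono n nn (ltnW (ltn_ord n)).
  by rewrite (big_pred1 (Ordinal fQ)).
pose D := C * N%:R / u N.
have NR : 0 < N%:R :> R by rewrite ltr0n (leq_trans _ Nn0).
have D0 : 0 < D by rewrite divr_gt0 // mulr_gt0.
have CCD k : `|CC k| <= D + 1.
  apply: le_trans (ler_norm_sum _ _ _) _.
  pose P n := [&& (n0 <= n)%N, (n < N)%N & floors u n == k].
  apply: (@le_trans _ _ (\sum_(n < N | P n) 1)).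
    rewrite big_mkcond [leRHS]big_mkcond /=; apply: ler_sum => n _.
    rewrite /P ltn_ord /= /c'; case: (n0 <= n)%N; case: (_ == _) => //=.
    by rewrite normr0.
  (* Values with the same integer part differ by less than [1], so the lower growth bound keeps
     their indices within distance [C N / u N]. *)
  apply: count_spread; first exact: ltW.
  move=> n n' /and3P[nn nN /eqP fn] /and3P[nn' nN' /eqP fn'] le_nn'.
  have h := low n n' N (leq_trans n20 nn) le_nn' (ltnW nN').
  rewrite ler_pdivlMr //; apply: le_trans h _.
  rewrite ler_piMr ?mulr_ge0 ?ltW //.
  have /andP[f1 f2] := truncn_itv (ltW (pos n (leq_trans n20 nn))).
  have /andP[g1 g2] := truncn_itv (ltW (pos n' (leq_trans n20 nn'))).
  move: f1 f2 g1 g2; rewrite -/(floors u n) -/(floors u n') fn fn' -natr1; lra.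
have h1 : rnorm (\sum_(n < N) (c' n)%:C *: iter (floors u n) T x) <= e / 2 * N%:R.
  have D10 : 0 < D + 1 by rewrite addr_gt0.
  have := Q0P Q Q0Q (fun k => (D + 1)^-1 * CC k) _.
  rewrite sumE.
  have -> : \sum_(n < Q) ((D + 1)^-1 * CC n)%:C *: iter n T x =
     ((D + 1)^-1)%:C *: \sum_(k < Q) (CC k)%:C *: iter k T x.
    rewrite scaler_sumr; apply: eq_bigr => k _.
    by rewrite rmorphM /= scalerA.
  rewrite rnormZ cabs_real gtr0_norm ?invr_gt0 //.
  rewrite mulrC ler_pdivrMr // => h.
  apply: le_trans (h _) _ => [k|].
    rewrite normrM gtr0_norm ?invr_gt0 //.
    by rewrite mulrC ler_pdivrMr // mul1r.
  apply: (@le_trans _ _ (e1 * (2 * u N) * (D + 1))).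
    by rewrite ler_pM2r // ler_pM2l.
  have -> : e1 * (2 * u N) * (D + 1) = 2 * e1 * (C * N%:R + u N).
    by rewrite /D; field; rewrite gt_eqF.
  have -> : e / 2 * N%:R = 2 * e1 * (C * N%:R + C2 * N%:R).
    by rewrite /e1; field; rewrite gt_eqF // addr_gt0.
  apply: ler_wpM2l; first by rewrite mulr_ge0 // ltW.
  by apply: lerD => //; exact: u_lin.
have N2R : N2%:R <= N%:R :> R by rewrite ler_nat.
have e20 : 0 < e / 2 by rewrite divr_gt0.
move: N2P; rewrite ler_pdivrMr // => N2P.
have h4 : N2%:R * (e / 2) <= N%:R * (e / 2) by rewrite ler_pM2r.
apply: le_trans (rnormD _ _) _; lra.
Qed.

End Null.

(** * A van der Corput inequality for power bounded operators *)

Section VanDerCorput.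
Variables (R : realType) (H : completeNormedModType R[i]).
Variable ip : {dot H for (@Num.conj R[i])}.
Hypothesis ip_norm : forall x : H, `|x| ^+ 2 = ip x x.
Variables (T : {linear H -> H}) (K : R).
Hypothesis K1 : 1 <= K.
Hypothesis TK : forall n v, rnorm (iter n T v) <= K * rnorm v.
Local Notation rip := (rip ip).

Let K0 : 0 < K. Proof. exact: lt_le_trans ltr01 K1. Qed.

Lemma rip_iter_bound p q x y :
  `|rip (iter p T x) (iter q T y)| <= K ^+ 2 * (rnorm x * rnorm y).
Proof.
apply: le_trans (rip_CS ip_norm _ _) _.
have -> : K ^+ 2 * (rnorm x * rnorm y) = (K * rnorm x) * (K * rnorm y) by ring.
by apply: ler_pM; rewrite ?rnorm_ge0.
Qed.

(* Replacing [T^(e + j)] by [T^j] in an average over [j < J] costs [O(e / J)];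
   the remaining sum over [i] only involves the differences [d i], because
   [T^(d i)] commutes with [T^j]. *)
Lemma correlation_bound (B J : nat) (d e : nat -> nat) (w : nat -> R) x (E y : R) :
  (forall i, (i < B)%N -> `|w i| <= 1) ->
  (forall i, (i < B)%N -> (e i)%:R <= E) ->
  rnorm (\sum_(i < B) (w i)%:C *: iter (d i) T x) <= y ->
  `|\sum_(i < B) \sum_(j < J)
      w i * rip (iter (d i + e i + j) T x) (iter (e i + j) T x)| <=
  J%:R * (K ^+ 2 * (y * rnorm x)) + B%:R * (2 * E * (K ^+ 2 * (rnorm x * rnorm x))).
Proof.
move=> w1 eE yP.
pose g i n := rip (iter (d i + n) T x) (iter n T x).
pose k := K ^+ 2 * (rnorm x * rnorm x).
have gk i n : `|g i n| <= k by exact: rip_iter_bound.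
have k0 : 0 <= k by rewrite !mulr_ge0 ?rnorm_ge0 // ltW.
have -> : \sum_(i < B) \sum_(j < J)
      w i * rip (iter (d i + e i + j) T x) (iter (e i + j) T x) =
   \sum_(i < B) w i * \sum_(j < J) g i j +
   \sum_(i < B) w i * (\sum_(j < J) g i (e i + j)%N - \sum_(j < J) g i j).
  rewrite -big_split /=; apply: eq_bigr => i _.
  rewrite -mulrDr addrC subrK mulr_sumr; apply: eq_bigr => j _.
  by rewrite /g addnA.
apply: le_trans (ler_normD _ _) _; apply: lerD.
  have -> : \sum_(i < B) w i * \sum_(j < J) g i j =
     \sum_(j < J) rip (iter j T (\sum_(i < B) (w i)%:C *: iter (d i) T x)) (iter j T x).
    under eq_bigr do rewrite mulr_sumr.
    rewrite exchange_big /=; apply: eq_bigr => j _.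
    rewrite iter_lin_sum rip_suml; apply: eq_bigr => i _.
    by rewrite iter_linZ ripZl -iterD addnC.
  apply: le_trans (ler_norm_sum _ _ _) _.
  apply: (@le_trans _ _ (\sum_(j < J) K ^+ 2 * (y * rnorm x))).
    apply: ler_sum => j _; apply: le_trans (rip_iter_bound _ _ _ _) _.
    by rewrite ler_wpM2l ?sqr_ge0 // ler_wpM2r ?rnorm_ge0.
  by rewrite sumr_const card_ord -(mulr_natl (K ^+ 2 * _)) lexx.
apply: le_trans (ler_norm_sum _ _ _) _.
apply: (@le_trans _ _ (\sum_(i < B) 2 * E * k)); last first.
  by rewrite sumr_const card_ord -(mulr_natl (2 * E * k)) lexx.
apply: ler_sum => i _; rewrite normrM.
apply: le_trans (ler_piMl _ (w1 i (ltn_ord i))) _; first by [].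
apply: le_trans (sum_shift_bound J (e i) (normr0 R) (@ler_normD _ R) (@normrN _ R) (gk i)) _.
by rewrite ler_wpM2r // ler_wpM2l // eE.
Qed.

(* Lowering the exponents of the window starting at [i] by [J - j] can only
   increase its norm by the factor [K]; average over [j < J] and expand. *)
Lemma window_bound (B L J : nat) (b : nat -> nat) (c : nat -> R) x (E y : R) :
  (forall n, `|c n| <= 1) ->
  (forall n, (J <= b n)%N) ->
  (forall n n', (n <= n')%N -> (b n <= b n')%N) ->
  (forall n, (n < B + L)%N -> (b n - J)%:R <= E) ->
  0 <= y ->
  (forall h h', (h' < h)%N -> (h < L)%N -> forall w : nat -> R,
     (forall i, `|w i| <= 1) ->
     rnorm (\sum_(i < B) (w i)%:C *: iter (b (i + h)%N - b (i + h')%N) T x) <= y) ->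
  J%:R * \sum_(i < B) rnorm (\sum_(h < L) (c (i + h)%N)%:C *: iter (b (i + h)%N) T x) ^+ 2
  <= K ^+ 2 * (L%:R * (B%:R * J%:R * (K ^+ 2 * (rnorm x * rnorm x))) +
       (L%:R * L%:R) * (J%:R * (K ^+ 2 * (y * rnorm x)) +
                 B%:R * (2 * E * (K ^+ 2 * (rnorm x * rnorm x))))).
Proof.
move=> c1 Jb bmono bE y0 yP.
set k := K ^+ 2 * (rnorm x * rnorm x).
have k0 : 0 <= k by rewrite !mulr_ge0 ?rnorm_ge0 // ltW.
pose ee n := (b n - J)%N.
pose q h h' i j := c (i + h)%N * c (i + h')%N *
  rip (iter (ee (i + h)%N + j) T x) (iter (ee (i + h')%N + j) T x).
have expand i : J%:R * rnorm (\sum_(h < L) (c (i + h)%N)%:C *: iter (b (i + h)%N) T x) ^+ 2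
    <= K ^+ 2 * \sum_(j < J) \sum_(h < L) \sum_(h' < L) q h h' i j.
  rewrite mulr_sumr -[X in X%:R * _](card_ord J) mulr_natl -sumr_const.
  apply: ler_sum => j _.
  have -> : \sum_(h < L) \sum_(h' < L) q h h' i j =
     rnorm (\sum_(h < L) (c (i + h)%N)%:C *: iter (ee (i + h)%N + j) T x) ^+ 2.
    rewrite -(ripvv ip_norm) rip_suml; apply: eq_bigr => h _.
    by rewrite rip_sumr; apply: eq_bigr => h' _; rewrite ripZZ.
  have -> : \sum_(h < L) (c (i + h)%N)%:C *: iter (b (i + h)%N) T x =
     iter (J - j) T (\sum_(h < L) (c (i + h)%N)%:C *: iter (ee (i + h)%N + j) T x).
    rewrite iter_lin_sum; apply: eq_bigr => h _; rewrite iter_linZ -iterD.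
    congr (_ *: iter _ T x); rewrite /ee; have := Jb (i + h)%N; have := ltn_ord j; lia.
  rewrite -exprMn ler_sqr ?nnegrE ?mulr_ge0 ?rnorm_ge0 //; exact: ltW.
rewrite mulr_sumr.
apply: (@le_trans _ _ (\sum_(i < B) (K ^+ 2 *
    \sum_(j < J) \sum_(h < L) \sum_(h' < L) q h h' i j))).
  by apply: ler_sum => i _; exact: expand.
rewrite -mulr_sumr ler_wpM2l ?sqr_ge0 //.
set bnd := J%:R * (K ^+ 2 * (y * rnorm x)) + B%:R * (2 * E * k).
have -> : \sum_(i < B) \sum_(j < J) \sum_(h < L) \sum_(h' < L) q h h' i j =
    \sum_(h < L) \sum_(h' < L) \sum_(i < B) \sum_(j < J) q h h' i j.
  under eq_bigr do rewrite exchange_big /=.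
  rewrite exchange_big /=; apply: eq_bigr => h _.
  under eq_bigr do rewrite exchange_big /=.
  by rewrite exchange_big.
have cc i i' : `|c i * c i'| <= 1 by rewrite normrM mulr_ile1.
have E0 : (0 < B + L)%N -> 0 <= E by move=> BL; apply: le_trans (bE 0%N BL).
have off (h h' : 'I_L) : (h' < h)%N -> \sum_(i < B) \sum_(j < J) q h h' i j <= bnd.
  move=> hh; apply: le_trans (ler_norm _) _.
  have := @correlation_bound B J (fun i => b (i + h)%N - b (i + h')%N)%N
    (fun i => ee (i + h')%N) (fun i => c (i + h)%N * c (i + h')%N) x E y.
  move=> /(_ (fun i _ => cc (i + h)%N (i + h')%N)) hb.
  apply: le_trans (hb _ _).
  - rewrite (_ : \sum_(i < B) _ = \sum_(i < B) \sum_(j < J) q h h' i j) //.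
    apply: eq_bigr => i _; apply: eq_bigr => j _; rewrite /q.
    congr (_ * rip (iter _ T x) _); congr (_ + _)%N.
    rewrite /ee; have := Jb (i + h')%N; have := bmono (i + h')%N (i + h)%N.
    rewrite leq_add2l => /(_ (ltnW hh)); lia.
  - by move=> i iB; apply: bE; have := ltn_ord h'; lia.
  - exact: (yP h h' hh (ltn_ord h) (fun i => c (i + h)%N * c (i + h')%N) (fun i => cc _ _)).
have bnd0 : (0 < B + L)%N -> 0 <= bnd.
  move=> /E0 E0'; apply: addr_ge0.
    by rewrite mulr_ge0 // mulr_ge0 ?sqr_ge0 // mulr_ge0 ?rnorm_ge0.
  by rewrite mulr_ge0 // mulr_ge0 // mulr_ge0.
(* Diagonal pairs get the trivial bound; the others reduce to [h' < h] by the symmetry of [rip]. *)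
have all (h h' : 'I_L) : \sum_(i < B) \sum_(j < J) q h h' i j <=
    (if h' == h then B%:R * J%:R * k else 0) + bnd.
  have BL : (0 < B + L)%N by have := ltn_ord h; lia.
  have [->|ne] := eqVneq h' h.
    apply: (@le_trans _ _ (B%:R * J%:R * k)); last by rewrite lerDl bnd0.
    apply: (@le_trans _ _ (\sum_(i < B) \sum_(j < J) k)).
      apply: ler_sum => i _; apply: ler_sum => j _.
      apply: le_trans (ler_norm _) _; rewrite /q normrM.
      apply: le_trans (ler_piMl _ (cc _ _)) _ => //.
      exact: rip_iter_bound.
    by rewrite !sumr_const !card_ord -(mulr_natl k) -(mulr_natl (_ * k)) mulrA lexx.
  rewrite add0r; case: (ltngtP h h') => [hh|hh|/val_inj hh]; last by rewrite hh eqxx in ne.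
    rewrite (_ : \sum_(i < B) _ = \sum_(i < B) \sum_(j < J) q h' h i j); first exact: off.
    apply: eq_bigr => i _; apply: eq_bigr => j _.
    by rewrite /q ripC (mulrC (c (i + h)%N)).
  exact: off.
apply: (@le_trans _ _ (\sum_(h < L) \sum_(h' < L)
    ((if h' == h then B%:R * J%:R * k else 0) + bnd))).
  by apply: ler_sum => h _; apply: ler_sum => h' _; exact: all.
under eq_bigr do rewrite big_split /= -big_mkcond /= big_pred1_eq.
rewrite big_split /= !sumr_const !card_ord.
have mulnE (z : R) : z *+ L = L%:R * z by rewrite mulr_natl.
by rewrite (mulnE (B%:R * _ * _)) (mulnE (bnd *+ L)) (mulnE bnd) -(mulrA L%:R L%:R) lexx.
Qed.

End VanDerCorput.

(** * Induction on the level *)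

Section Levels.
Variable R : realType.
Implicit Types u : nat -> R.

(** The count starts at [0]: a function of class [P_m] gives level [m - 1]. *)
Fixpoint level (m : nat) u : Prop :=
  if m is m'.+1 then forall h, (0 < h)%N -> level m' (diff u h) else base u.

Definition eventually_nondec u := exists n0, forall n n',
  (n0 <= n)%N -> (n <= n')%N -> u n <= u n'.

Lemma telescope_le u (A : R) n d :
  (forall i, (n <= i)%N -> (i < n + d)%N -> diff u 1 i <= A) ->
  u (n + d)%N - u n <= d%:R * A.
Proof.
elim: d => [|d IH] hA; first by rewrite addn0 subrr mul0r.
have h1 : u (n + d)%N - u n <= d%:R * A.
  by apply: IH => i ni id; apply: hA => //; rewrite addnS ltnS ltnW.
have := hA (n + d)%N (leq_addr _ _); rewrite addnS ltnSn => /(_ isT).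
rewrite /diff addn1 -natr1; lra.
Qed.

Lemma telescope_ge u (A : R) n d :
  (forall i, (n <= i)%N -> (i < n + d)%N -> A <= diff u 1 i) ->
  d%:R * A <= u (n + d)%N - u n.
Proof.
move=> hA.
have : - u (n + d)%N - - u n <= d%:R * - A.
  apply: (@telescope_le (fun i => - u i)) => i ni id.
  by have := hA i ni id; rewrite /diff; lra.
lra.
Qed.

Lemma diff_infty u : to_infty (diff u 1) -> to_infty u.
Proof.
move=> /(_ 1) [n0 w1] A.
pose k := (Num.truncn (A - u n0)).+1.
exists (n0 + k)%N => n nn.
have -> : n = (n0 + (n - n0))%N by rewrite subnKC // (leq_trans _ nn) // leq_addr.
have := @telescope_ge u 1 n0 (n - n0) (fun i ni _ => w1 i ni).
have : k%:R <= (n - n0)%:R :> R by rewrite ler_nat leq_subRL // (leq_trans _ nn) // leq_addr.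
have := ltW (truncnS_gt (A - u n0)); rewrite -/k mulr1; lra.
Qed.

Lemma diff_nondec u : to_infty (diff u 1) -> eventually_nondec u.
Proof.
move=> /(_ 0) [n0 w0]; exists n0 => n n' nn nn'.
have := @telescope_ge u 0 n (n' - n) (fun i ni _ => w0 i (leq_trans nn ni)).
by rewrite subnKC // mulr0 subr_ge0.
Qed.

(** Let [w = diff u 1]. Over one doubling [w] grows at most by the factor [1 + C]. Hence
    [u n' - u n <= (n' - n) (1 + C) w n], while summing [w] over about [n / 2] indices before [n]
    gives [u n >= (n / 4) w n / (1 + C)]; comparing the two yields the constant [4 (1 + C)^2]. *)
Lemma diff_reg u : to_infty u -> reg (diff u 1) -> reg u.
Proof.
move=> /(_ 1) [n1 u1] [C [n0 [C0 wpos wreg]]].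
have C1 : 0 < 1 + C by rewrite addr_gt0.
exists (4 * (1 + C) ^+ 2), (2 * maxn n0 n1 + 2)%N; split.
- by rewrite mulr_gt0 // exprn_gt0.
- move=> n nn; apply: (lt_le_trans ltr01); apply: u1; have := leq_maxr n0 n1; lia.
move=> n n' nn nn' n'n.
have w_le i j : (n0 < i)%N -> (i <= j)%N -> (j <= 2 * i)%N ->
    diff u 1 j <= (1 + C) * diff u 1 i.
  move=> n0i ij ji; have := wreg i j (ltnW n0i) ij ji.
  have iR : 0 < i%:R :> R by rewrite ltr0n (leq_ltn_trans _ n0i).
  have wi := wpos i (ltnW n0i).
  have : C * (j%:R - i%:R) * diff u 1 i <= C * i%:R * diff u 1 i.
    rewrite ler_pM2r // ler_pM2l // lerBlDr -natrD ler_nat; lia.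
  move=> h1 h2; rewrite -(ler_pM2l iR); lra.
have m0 := leq_maxl n0 n1; have m1 := leq_maxr n0 n1.
have n0n : (n0 < n)%N by lia.
have wn := wpos n (ltnW n0n).
have up : u n' - u n <= (n'%:R - n%:R) * ((1 + C) * diff u 1 n).
  have := @telescope_le u ((1 + C) * diff u 1 n) n (n' - n).
  rewrite subnKC // natrB //; apply => i ni id.
  by apply: w_le => //; lia.
pose k := n./2.
have nk : (n <= 4 * k)%N by rewrite /k; have := odd_double_half n; case: odd; lia.
have kn : (2 * k <= n)%N by rewrite /k; have := odd_double_half n; case: odd; lia.
have low : k%:R * (diff u 1 n / (1 + C)) <= u n.
  have := @telescope_ge u (diff u 1 n / (1 + C)) (n - k) k.
  rewrite subnK; last by lia.
  have : 1 <= u (n - k)%N by apply: u1; lia.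
  move=> h1 h2; apply: le_trans (h2 _) _; last by lra.
  move=> i ni id; rewrite ler_pdivrMr // mulrC; apply: w_le; lia.
have nR : n%:R <= 4 * k%:R :> R by rewrite -natrM ler_nat.
have dR : 0 <= n'%:R - n%:R :> R by rewrite subr_ge0 ler_nat.
apply: le_trans (ler_wpM2l (ler0n _ n) up) _.
have h : n%:R * (diff u 1 n / (1 + C)) <= 4 * u n.
  apply: (@le_trans _ _ (4 * k%:R * (diff u 1 n / (1 + C)))); last by lra.
  by rewrite ler_wpM2r // ltW // divr_gt0.
have -> : n%:R * ((n'%:R - n%:R) * ((1 + C) * diff u 1 n)) =
    (n'%:R - n%:R) * (1 + C) ^+ 2 * (n%:R * (diff u 1 n / (1 + C))).
  by field; rewrite gt_eqF.
have -> : 4 * (1 + C) ^+ 2 * (n'%:R - n%:R) * u n =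
    (n'%:R - n%:R) * (1 + C) ^+ 2 * (4 * u n) by ring.
by rewrite ler_wpM2l // mulr_ge0 // sqr_ge0.
Qed.

Lemma level_facts m u : level m u -> [/\ reg u, to_infty u & eventually_nondec u].
Proof.
elim: m u => [|m IH] u /= lu.
  by split; [exact: base_reg|exact: base_infty|exact: base_nondec].
have [rw iw _] := IH _ (lu 1%N isT).
have iu := diff_infty iw.
by split => //; [exact: diff_reg|exact: diff_nondec].
Qed.

(** The alternative is the one required by [null_floor], so null averages along [floors (diff u h)]
    carry over to the differences of [floors u]. *)
Lemma floors_diff u h : to_infty u -> eventually_nondec u ->
  exists n0, forall n, (n0 <= n)%N ->
    (floors u (n + h) - floors u n = floors (diff u h) n \/
     floors u (n + h) - floors u n = (floors (diff u h) n).+1)%N.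
Proof.
have nat_aux (p q t : nat) : (p <= q)%N -> (q < p + t + 2)%N -> (p + t < q.+1)%N ->
    (q - p = t \/ q - p = t.+1)%N by lia.
move=> /(_ 0) [n1 u0] [n2 mono]; exists (maxn n1 n2) => n.
rewrite geq_max => /andP[nn1 nn2].
have un := u0 n nn1; have unh := u0 (n + h)%N (leq_trans nn1 (leq_addr _ _)).
have le_u := mono n (n + h)%N nn2 (leq_addr _ _).
have d0 : 0 <= diff u h n by rewrite subr_ge0.
have pq : (floors u n <= floors u (n + h))%N by exact: le_truncn.
have /andP[p1 p2] := truncn_itv un; have /andP[q1 q2] := truncn_itv unh.
have /andP[t1 t2] := truncn_itv d0.
move: p1 p2 q1 q2 t1 t2 pq; rewrite /floors /diff.
set p := Num.truncn (u n); set q := Num.truncn (u (n + h)%N).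
set t := Num.truncn (u (n + h)%N - u n) => p1 p2 q1 q2 t1 t2 pq.
apply: nat_aux => //.
  by rewrite -(ltr_nat R) !natrD; move: p2 t2; rewrite -!natr1; lra.
by rewrite -(ltr_nat R) !natrD; lra.
Qed.

End Levels.

(** * The inductive step and null averages at every level *)

Section NullLevels.
Variables (R : realType) (H : completeNormedModType R[i]).
Variable ip : {dot H for (@Num.conj R[i])}.
Hypothesis ip_norm : forall x : H, `|x| ^+ 2 = ip x x.
Variables (T : {linear H -> H}) (K : R).
Hypothesis K1 : 1 <= K.
Hypothesis TK : forall n v, rnorm (iter n T v) <= K * rnorm v.
Implicit Types u : nat -> R.

Let K0 : 0 < K. Proof. exact: lt_le_trans ltr01 K1. Qed.

(* The blocks are so short that the exponents vary by at most a factor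
   [1 + eps] on them, which makes the error term of [window_bound] small. *)
Lemma null_block u x (eta : R) : reg u -> to_infty u -> eventually_nondec u ->
  (forall h x, (0 < h)%N -> null T (floors (diff u h)) x) -> 0 < eta ->
  exists delta, [/\ 0 < delta, delta <= 1 / 2 & exists P0, forall P B,
    (P0 <= P)%N -> B%:R <= delta * P%:R ->
    forall c : nat -> R, (forall n, `|c n| <= 1) ->
    rnorm (\sum_(i < B) (c (P + i)%N)%:C *: iter (floors u (P + i)) T x)
      <= eta * delta * P%:R].
Proof.
move=> [C [n2 [C0 pos ureg]]] iu nu dnull eta0.
have [n1 mono] := nu.
have nullD h y : null T (fun n => floors u (n + h.+1) - floors u n)%N y.
  have [m0 m0P] := floors_diff h.+1 iu nu.
  by apply: (null_floor K1 TK m0P) => z; exact: dnull.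
set k := K ^+ 2 * (rnorm x * rnorm x).
have k0 : 0 <= k by rewrite !mulr_ge0 ?rnorm_ge0 // ltW.
(* The final bound collects five errors of size at most [tau * delta * P]. The parameters are chosen
   in the order [tau], [L] (diagonal terms), [eps] (variation of the exponents), [delta], [e1]
   (correlations), each depending only on the data and the earlier ones. *)
pose tau := eta / 5; have tau0 : 0 < tau by rewrite divr_gt0.
pose kap := K ^+ 2 * k / tau.
have kap0 : 0 <= kap.
  by apply: divr_ge0; [rewrite mulr_ge0 ?sqr_ge0|exact: ltW].
pose L := (Num.truncn (kap / tau)).+1.
have LR : 0 < L%:R :> R by rewrite ltr0n.
have L1 : 1 <= L%:R :> R by rewrite ler1n.
have kapL : kap <= L%:R * tau by rewrite -ler_pdivrMr //; exact/ltW/truncnS_gt.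
pose eps := tau / (2 * kap + 1).
have eps0 : 0 < eps by rewrite divr_gt0 // ltr_wpDl // mulr_ge0.
have epsP : 2 * kap * eps <= tau.
  have : eps * (2 * kap + 1) = tau by rewrite divfK // gt_eqF // ltr_wpDl // mulr_ge0.
  lra.
pose delta := Num.min (1 / 2) (eps / (4 * C)).
have delta0 : 0 < delta by rewrite lt_min; apply/andP; split; rewrite divr_gt0 // mulr_gt0.
have delta1 : delta <= 1 / 2 by rewrite ge_min lexx.
have deltaC : delta * (4 * C) <= eps.
  by rewrite -ler_pdivlMr ?mulr_gt0 // ge_min lexx orbT.
exists delta; split=> //.
pose K4 := K ^+ 2 * K ^+ 2 * rnorm x / tau.
have K40 : 0 <= K4.
  by apply: divr_ge0; [rewrite mulr_ge0 ?rnorm_ge0 // mulr_ge0 ?sqr_ge0|exact: ltW].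
pose e1 := tau * delta / (3 * K4 + 1).
have den0 : 0 < 3 * K4 + 1 by rewrite ltr_wpDl // mulr_ge0.
have e10 : 0 < e1 by rewrite divr_gt0 // mulr_gt0.
have e1P : 3 * K4 * e1 <= tau * delta.
  have : e1 * (3 * K4 + 1) = tau * delta by rewrite divfK // gt_eqF.
  lra.
have /choice [Ng NgP] h := nullD h x e1 e10.
have [Pu PuP] := iu (2 / eps + 2).
have [Pd PdP] : exists P : nat,
    (2 * L%:R * (K * rnorm x) + L%:R * tau) / (tau * delta) <= P%:R.
  by eexists; exact/ltW/truncnS_gt.
(* Only gaps [g + 1] with [g < L] occur, so one threshold serves them all. *)
pose Nmax := (\max_(g < L) Ng g)%N.
exists (maxn (maxn n1 n2) (maxn Nmax (maxn Pu Pd))).+1 => P B.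
rewrite -[(_ < P)%N]/(_ < P)%N => Pbig BP c c1.
have /andP[/andP[Pn1 Pn2] /and3P[PN PPu PPd]] :
    ((n1 <= P) && (n2 <= P) && [&& Nmax <= P, Pu <= P & Pd <= P])%N.
  by move: (ltnW Pbig); rewrite !geq_max.
have P1 : (0 < P)%N by exact: leq_ltn_trans Pbig.
have PR : 0 < P%:R :> R by rewrite ltr0n.
have PdR : Pd%:R <= P%:R :> R by rewrite ler_nat.
have td0 : 0 < tau * delta by rewrite mulr_gt0.
have [hP1 hP2] : 2 * L%:R * (K * rnorm x) <= tau * delta * P%:R /\
    L%:R <= delta * P%:R.
  move: PdP; rewrite ler_pdivrMr // => PdP.
  have : Pd%:R * (tau * delta) <= P%:R * (tau * delta) by rewrite ler_pM2r.
  have a0 : 0 <= 2 * L%:R * (K * rnorm x) by rewrite !mulr_ge0 ?rnorm_ge0 // ltW.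
  have b0 : 0 <= L%:R * tau by rewrite mulr_ge0 // ltW.
  move=> h; split; first by lra.
  rewrite -(ler_pM2r tau0); lra.
have BLP : (B + L <= P)%N.
  rewrite -(ler_nat R) natrD.
  have : delta * P%:R <= 1 / 2 * P%:R by rewrite ler_pM2r.
  lra.
pose a := floors u; pose J := a P; pose b n := a (P + n)%N.
have bmono n n' : (n <= n')%N -> (b n <= b n')%N.
  move=> nn'; apply: le_truncn; apply: mono; last by rewrite leq_add2l.
  exact: leq_trans (leq_addr _ _).
have Jb n : (J <= b n)%N.
  by have := bmono 0%N n (leq0n _); rewrite /b addn0.
have uP : 0 < u P by exact: pos.
have JR : 2 / eps + 1 <= J%:R.
  have := PuP P PPu; have /andP[_] := truncn_itv (ltW uP).
  rewrite -/(floors u P) -/a -/J -natr1; lra.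
(* The loss [1 + eps / 2] due to rounding is thus at most half of [eps * J]. *)
have epsJ : 2 + eps <= eps * J%:R.
  have : eps * (2 / eps + 1) = 2 + eps by field; rewrite gt_eqF.
  by move=> <-; rewrite ler_pM2l.
have J0 : 0 < J%:R :> R.
  by apply: lt_le_trans JR; rewrite ltr_wpDl // divr_ge0 // ltW.
have bE n : (n < B + L)%N -> (b n - J)%:R <= eps * J%:R.
  move=> nBL; rewrite natrB //.
  have nP : (P + n <= 2 * P)%N.
    by rewrite mul2n -addnn leq_add2l; apply: leq_trans BLP; exact: ltnW.
  have := ureg P (P + n)%N Pn2 (leq_addr _ _) nP; rewrite natrD addrAC subrr add0r => h.
  have h2 : n%:R <= 2 * delta * P%:R.
    apply: (@le_trans _ _ (B + L)%:R); first by rewrite ler_nat ltnW.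
    by rewrite natrD; lra.
  have h3 : u (P + n)%N - u P <= eps / 2 * u P.
    rewrite -(ler_pM2l PR); apply: le_trans h _.
    apply: (@le_trans _ _ (C * (2 * delta * P%:R) * u P)).
      by rewrite ler_pM2r // ler_pM2l.
    have := ler_wpM2r (mulr_ge0 (ltW PR) (ltW uP)) deltaC; lra.
  have /andP[_ j2] := truncn_itv (ltW uP).
  have uPn : 0 <= u (P + n)%N by apply/ltW/pos; exact: leq_trans (leq_addr _ _).
  have /andP[b1 _] := truncn_itv uPn.
  move: j2 b1; rewrite -/(floors u P) -/(floors u (P + n)) -/a -/(b n) -/J -natr1 => j2 b1.
  have : eps / 2 * u P <= eps / 2 * (J%:R + 1) by rewrite ler_pM2l ?ltW // divr_gt0.
  have : eps / 2 * J%:R = eps * J%:R / 2 by ring.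
  lra.
pose y := e1 * (2 * P%:R).
have y0 : 0 <= y by rewrite mulr_ge0 ?(ltW e10) // mulr_ge0.
have yP h h' : (h' < h)%N -> (h < L)%N -> forall w : nat -> R,
     (forall i, `|w i| <= 1) ->
     rnorm (\sum_(i < B) (w i)%:C *: iter (b (i + h)%N - b (i + h')%N) T x) <= y.
  move=> hh hL w w1.
  pose g := (h - h').-1.
  have gL : (g < L)%N.
    by apply: leq_ltn_trans (leq_pred _) _; exact: leq_ltn_trans (leq_subr _ _) hL.
  have gE i : (P + h' + i + g.+1 = P + (i + h))%N.
    by rewrite prednK ?subn_gt0 // -!addnA; congr (P + _)%N; rewrite addnCA subnKC // ltnW.
  pose N := (P + h' + B)%N.
  have NN : (Ng g <= N)%N.
    apply: (@leq_trans P); last by rewrite /N -addnA leq_addr.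
    apply: leq_trans PN; exact: (@leq_bigmax _ (fun g : 'I_L => Ng g) (Ordinal gL)).
  (* [null] concerns sums starting at [0]: the coefficients are set to [0] below [P + h'], and the
     total length is at most [2 P], whence the value of [y]. *)
  pose w' n := if (n < P + h')%N then 0 else w (n - (P + h'))%N.
  have w'1 n : `|w' n| <= 1 by rewrite /w'; case: ifP; rewrite ?normr0.
  have := NgP g N NN w' w'1.
  rewrite (@sum_ord_tail _ (fun n => (w' n)%:C *: iter (floors u (n + g.+1) - floors u n) T x) B N); last first.
    by rewrite leq_addl.
  rewrite /N addnK big1 ?add0r => [|n _]; last by rewrite /w' ltn_ord scale0r.
  rewrite (_ : \sum_(j < B) _ = \sum_(i < B) (w i)%:C *: iter (b (i + h)%N - b (i + h')%N) T x).
    move=> hN; apply: le_trans hN _; rewrite /y ler_pM2l //.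
    rewrite -natrM ler_nat mul2n -addnn -addnA leq_add2l.
    apply: leq_trans BLP; rewrite addnC leq_add2l.
    exact: ltnW (ltn_trans hh hL).
  apply: eq_bigr => i _; rewrite /w' ltnNge leq_addr /= addKn.
  by rewrite /b /a gE -addnA (addnC h').
have := window_bound ip_norm K1 TK (c := fun n => c (P + n)%N) (fun n => c1 _) Jb bmono bE y0 yP.
pose V n := (c (P + n)%N)%:C *: iter (b n) T x.
rewrite (_ : \sum_(i < B) rnorm _ ^+ 2 = \sum_(i < B) rnorm (\sum_(h < L) V (i + h)%N) ^+ 2) //.
rewrite -/k; set W := \sum_(i < B) _ => hW.
have Vb n : rnorm (V n) <= K * rnorm x.
  exact: le_trans (rnormZ_le _ (c1 _)) (TK _ _).
have hW2 : W <= K ^+ 2 * (L%:R * (B%:R * k) + L%:R * L%:R *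
      (K ^+ 2 * (y * rnorm x) + B%:R * (2 * eps * k))).
  by rewrite -(ler_pM2l J0); apply: le_trans hW _; rewrite le_eqVlt; apply/orP; left; apply/eqP; ring.
(* Averaging over [L] shifts replaces each term by a window of length [L]; only the ends of the
   block contribute to the error. *)
have hS : L%:R * rnorm (\sum_(i < B) V i) <=
    \sum_(i < B) rnorm (\sum_(h < L) V (i + h)%N) + L%:R * (2 * L%:R * (K * rnorm x)).
  have -> : L%:R * rnorm (\sum_(i < B) V i) = rnorm (\sum_(h < L) \sum_(i < B) V i).
    by rewrite sumr_const card_ord rnormMn.
  have -> : \sum_(h < L) \sum_(i < B) V i = \sum_(i < B) \sum_(h < L) V (i + h)%N -
      \sum_(h < L) (\sum_(i < B) V (h + i)%N - \sum_(i < B) V i).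
    rewrite [X in _ = X - _]exchange_big -sumrB; apply: eq_bigr => h _ /=.
    have -> : \sum_(i < B) V (i + h)%N = \sum_(i < B) V (h + i)%N.
      by apply: eq_bigr => i _; rewrite addnC.
    by rewrite subKr.
  apply: le_trans (rnormB _ _) _; apply: lerD; first exact: rnorm_sum.
  apply: le_trans (rnorm_sum _ _ _) _.
  rewrite -[X in X%:R * _](card_ord L) mulr_natl -sumr_const; apply: ler_sum => h _.
  apply: le_trans (sum_shift_bound B h (rnorm0 H) (@rnormD _ H) (@rnormN _ H) Vb) _.
  apply: ler_wpM2r; first by rewrite mulr_ge0 ?rnorm_ge0 // ltW.
  by rewrite ler_pM2l // ler_nat ltnW.
(* The inequality [s <= a + s^2 / a] with [a = L * tau] takes the place of Cauchy-Schwarz and avoids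
   square roots. *)
have hA : \sum_(i < B) rnorm (\sum_(h < L) V (i + h)%N) <= B%:R * (L%:R * tau) + W / (L%:R * tau).
  have Lt : 0 < L%:R * tau by rewrite mulr_gt0.
  rewrite /W mulr_suml -[X in X%:R * _](card_ord B) mulr_natl -sumr_const -big_split /=.
  apply: ler_sum => i _; set s := rnorm _.
  have : 0 <= (L%:R * tau - s) ^+ 2 + s ^+ 2 + (L%:R * tau) ^+ 2 by rewrite !addr_ge0 ?sqr_ge0.
  rewrite -(ler_pM2r Lt) mulrDl divfK ?gt_eqF // => h; lra.
suff : L%:R * rnorm (\sum_(i < B) V i) <= L%:R * (eta * delta * P%:R).
  by rewrite ler_pM2l.
apply: le_trans hS _.
have hW3 : W / (L%:R * tau) <= B%:R * kap + L%:R * (K4 * y + B%:R * (2 * eps * kap)).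
  rewrite ler_pdivrMr ?mulr_gt0 //; apply: le_trans hW2 _.
  by rewrite /kap /K4 le_eqVlt; apply/orP; left; apply/eqP; field; rewrite gt_eqF.
have i1 : B%:R * kap <= L%:R * (tau * (delta * P%:R)).
  have := ler_pM (ler0n R B) kap0 BP kapL; lra.
have i2 : B%:R * (2 * eps * kap) <= tau * (delta * P%:R).
  have e0 : 0 <= 2 * eps * kap.
    by rewrite mulr_ge0 // mulr_ge0 // ltW.
  have ek : 2 * eps * kap <= tau by rewrite mulrAC.
  have := ler_pM (ler0n R B) e0 BP ek; rewrite [leRHS]mulrC => h.
  by apply: (le_trans h).
have i3 : K4 * y <= tau * (delta * P%:R).
  have := ler_wpM2r (ltW PR) e1P.
  have : 0 <= K4 * e1 * P%:R by rewrite mulr_ge0 // mulr_ge0 // ltW.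
  rewrite /y; lra.
have i4 : B%:R * (L%:R * tau) <= L%:R * (tau * (delta * P%:R)).
  have := ler_wpM2r (ltW (mulr_gt0 LR tau0)) BP; lra.
have -> : eta * delta * P%:R = 5 * (tau * (delta * P%:R)) by rewrite /tau; field.
have i5 : L%:R * (K4 * y + B%:R * (2 * eps * kap) + 2 * L%:R * (K * rnorm x)) <=
    L%:R * (3 * (tau * (delta * P%:R))).
  by rewrite ler_pM2l //; lra.
lra.
Qed.

(** Strong induction on [N], cutting off a final block of length [B] close to [delta * N / 2]. The
    block starts beyond [N / 2], and [delta * N <= 4 B] turns the bound of [null_block] into [e / 2]
    per index. *)
Lemma null_vdc u x : reg u -> to_infty u -> eventually_nondec u ->
  (forall h x, (0 < h)%N -> null T (floors (diff u h)) x) -> null T (floors u) x.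
Proof.
have nat_aux (N B P : nat) : (2 * P <= N)%N -> (2 * B <= N)%N -> (0 < B)%N ->
    [/\ P <= N - B, B <= N & N - B < N]%N by move=> *; split; lia.
move=> ru iu nu dnull e e0.
have e80 : 0 < e / 8 by rewrite divr_gt0.
have [delta [delta0 delta1 [P0 P0P]]] := null_block x ru iu nu dnull e80.
have [N1 N1P] : exists N1 : nat, 4 / delta <= N1%:R.
  by eexists; exact/ltW/truncnS_gt.
pose M := maxn (2 * P0) N1.
have total (c : nat -> R) : (forall n, `|c n| <= 1) -> forall N,
   rnorm (\sum_(n < N) (c n)%:C *: iter (floors u n) T x) <=
     M%:R * (K * rnorm x) + e / 2 * N%:R.
  move=> c1; elim/ltn_ind => N IH.
  have [MN|NM] := leqP M N.
    have NR : N1%:R <= N%:R :> R.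
      by rewrite ler_nat; apply: leq_trans MN; exact: leq_maxr.
    have dN : 4 <= delta * N%:R.
      by rewrite mulrC -ler_pdivrMr //; exact: le_trans N1P NR.
    have dN0 : 0 <= delta * N%:R / 2 by rewrite divr_ge0 //; lra.
    pose B := Num.truncn (delta * N%:R / 2).
    have /andP[B1 B2] := truncn_itv dN0; rewrite -/B in B1 B2.
    rewrite -(natr1 B) in B2.
    have dN2 : delta * N%:R <= 1 / 2 * N%:R by rewrite ler_wpM2r.
    have BN : (2 * B <= N)%N by rewrite -(ler_nat R) natrM; lra.
    have B0 : (0 < B)%N by rewrite -(ltr0n R); lra.
    have P0N2 : (2 * P0 <= N)%N by apply: leq_trans MN; exact: leq_maxl.
    have [P0N BN' NBN] := nat_aux _ _ _ P0N2 BN B0.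
    have NB : (N - B)%:R = N%:R - B%:R :> R by rewrite natrB.
    have BdP : B%:R <= delta * (N - B)%:R.
      have : N%:R / 2 <= (N - B)%:R :> R.
        have : 2 * B%:R <= N%:R :> R by rewrite -natrM ler_nat.
        by rewrite NB; lra.
      rewrite -(ler_pM2l delta0); lra.
    rewrite (sum_ord_tail (fun n => (c n)%:C *: iter (floors u n) T x) BN').
    apply: le_trans (rnormD _ _) _.
    have h1 := IH (N - B)%N NBN.
    have h2 := P0P (N - B)%N B P0N BdP c c1.
    have h3 : e / 8 * delta * (N - B)%:R <= e / 8 * (delta * N%:R).
      by rewrite -mulrA ler_pM2l // ler_pM2l // ler_nat leq_subr.
    have h4 : e / 8 * (delta * N%:R) <= e / 8 * (4 * B%:R).
      by rewrite ler_pM2l //; lra.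
    rewrite NB in h1 h2 h3; lra.
  have hp := @prefix_bound _ _ T K K1 TK (floors u) (fun n => if (n < N)%N then c n else 0) x N N.
  rewrite (eq_bigr (fun n : 'I_N => (if (n < N)%N then c n else 0)%:C *: iter (floors u n) T x)); last first.
    by move=> n _; rewrite ltn_ord.
  apply: le_trans (hp _ _) _ => [n|n Nn|].
  - by case: ifP => // _; rewrite normr0.
  - by rewrite ltnNge Nn.
  have : N%:R * (K * rnorm x) <= M%:R * (K * rnorm x).
    by rewrite ler_wpM2r ?mulr_ge0 ?rnorm_ge0 ?(ltW K0) // ler_nat ltnW.
  have : 0 <= e / 2 * N%:R by rewrite mulr_ge0 // divr_ge0 // ltW.
  lra.
have [N2 N2P] : exists N2 : nat, M%:R * (K * rnorm x) / (e / 2) <= N2%:R.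
  by eexists; exact/ltW/truncnS_gt.
exists N2 => N N2N c c1; apply: le_trans (total c c1 N) _.
have N2R : N2%:R <= N%:R :> R by rewrite ler_nat.
have e20 : 0 < e / 2 by rewrite divr_gt0.
move: N2P; rewrite ler_pdivrMr // => N2P.
have : N2%:R * (e / 2) <= N%:R * (e / 2) by rewrite ler_pM2r.
lra.
Qed.

Hypothesis noeig : forall (z : R[i]) (v : H), cabs z = 1 -> T v = z *: v -> v = 0.

Lemma null_level m u x : level m u -> null T (floors u) x.
Proof.
elim: m u x => [|m IH] u x lu; first exact: (null_base ip_norm K1 TK noeig).
have [ru iu nu] := level_facts lu.
by apply: null_vdc => // h y h0; apply: IH; exact: lu.
Qed.

End NullLevels.

(** * Iterated differences of functions of class P_m *)

Section IteratedDifferences.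
Variable R : realType.
Implicit Types (g f : R -> R) (hs : seq nat).

Fixpoint fdiff hs g (t : R) : R :=
  if hs is h :: hs' then fdiff hs' (fun s => g (s + h%:R) - g s) t else g t.

Lemma fdiff_shift hs g (a t : R) : fdiff hs (fun s => g (s + a)) t = fdiff hs g (t + a).
Proof.
elim: hs g t => //= h hs IH g t; rewrite -IH; congr (fdiff hs _ t).
by apply/funext => s; rewrite addrAC.
Qed.

Lemma fdiffB hs g g' t : fdiff hs (fun s => g s - g' s) t = fdiff hs g t - fdiff hs g' t.
Proof.
elim: hs g g' t => //= h hs IH g g' t; rewrite -IH; congr (fdiff hs _ t).
by apply/funext => s; ring.
Qed.

(** Difference operators commute, so the step [h], applied first in the definition, may be taken
    last, as in [diff]. *)
Lemma fdiff_cons h hs g t :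
  fdiff (h :: hs) g t = fdiff hs g (t + h%:R) - fdiff hs g t.
Proof. by rewrite /= fdiffB fdiff_shift. Qed.

Lemma mvt_ge g g' (a b : R) : a <= b ->
  (forall s, a <= s <= b -> is_derive s 1 g (g' s)) ->
  exists2 c, a <= c <= b & g b - g a = g' c * (b - a).
Proof.
move=> ab dg.
have [||c cab gE] := @MVT_segment R g g' a b ab.
- move=> s; rewrite in_itv /= => /andP[/ltW s1 /ltW s2].
  by apply: dg; rewrite s1 s2.
- apply: derivable_within_continuous => s; rewrite in_itv /= => /dg ds.
  exact: ex_derive.
- by exists c => //; move: cab; rewrite in_itv.
Qed.

(** Mean value theorem for iterated differences. The [F k] stand for successive derivatives but
    remain abstract, so that the induction hypothesis applies to their differences of step [h]. *)
Lemma fdiff_bounds hs (F : nat -> R -> R) (t A B : R) :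
  (forall k s, (k < size hs)%N -> t <= s -> is_derive s 1 (F k) (F k.+1 s)) ->
  (forall s, t <= s <= t + (sumn hs)%:R -> A <= F (size hs) s <= B) ->
  (\prod_(h <- hs) h)%:R * A <= fdiff hs (F 0%N) t <= (\prod_(h <- hs) h)%:R * B.
Proof.
elim: hs F t A B => [|h hs IH] F t A B dF bF /=.
  by rewrite big_nil !mul1r; apply: bF; rewrite addr0 lexx.
have := IH (fun k s => F k (s + h%:R) - F k s) t (h%:R * A) (h%:R * B).
have mulE z : (\prod_(j <- h :: hs) j)%:R * z = (\prod_(j <- hs) j)%:R * (h%:R * z) :> R.
  by rewrite big_cons natrM; ring.
rewrite !mulE; apply.
- move=> k s khs ts.
  have d1 : is_derive (shift h%:R s) 1 (F k) (F k.+1 (s + h%:R)).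
    by apply: dF; [exact: leqW|rewrite ler_wpDr].
  have d2 : is_derive s 1 (fun r => F k (r + h%:R)) (F k.+1 (s + h%:R)).
    have d2 : is_derive s 1 (F k \o shift h%:R) (F k.+1 (s + h%:R) * 1).
      exact: (@is_derive1_comp R _ (shift (h%:R : R)) s _ 1 d1 (is_derive_shift s 1 _)).
    by rewrite mulr1 in d2.
  have d3 : is_derive s 1 (F k) (F k.+1 s) by apply: dF => //; exact: leqW.
  exact: (is_deriveB d2 d3).
move=> s /andP[ts st].
have sh : s <= s + h%:R by rewrite lerDl.
have [|c /andP[sc cs] ->] := @mvt_ge (F (size hs)) (F (size hs).+1) _ _ sh.
  by move=> r /andP[sr _]; apply: dF => //; exact: le_trans sr.
have /bF/andP[Ac cB] : t <= c <= t + (sumn (h :: hs))%:R.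
  rewrite (le_trans ts sc) /= natrD; lra.
by rewrite addrAC subrr add0r ![_ * h%:R]mulrC !ler_wpM2l.
Qed.

(** A finite upper limit is a finite supremum near infinity; the two bounds are merged into one
    constant [C] and one threshold [t1]. *)
Lemma class_P_bounds m t0 f : class_P m t0 f -> exists C t1 : R, [/\ 0 < C, 0 < t1,
  forall k (t : R), (k < m)%N -> t1 <= t -> is_derive t 1 f^`(k)%classic (f^`(k.+1)%classic t),
  forall t : R, t1 <= t -> 0 < f^`(m.-1)%classic t /\ 0 < f^`(m)%classic t &
  forall t : R, t1 <= t -> f^`(m.-1)%classic t <= C * t * f^`(m)%classic t /\
    forall s, t <= s -> f^`(m)%classic s <= C * f^`(m)%classic t].
Proof.
case=> m1 _ [D1 [_ der]] _ [D2 [_ pos]] lim1 lim2.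
have bound (g : R -> \bar R) : (limf_esup g (+oo)%R < +oo)%E ->
    exists (C D : R), forall t, D < t -> (g t <= C%:E)%E.
  move=> /ereal_inf_lt [_ [V [D [_ VD]] <-]] supV.
  have [C CP] : exists C : R, (ereal_sup [set g x | x in V] <= C%:E)%E.
    case: (ereal_sup _) supV => [r|//|] _; first by exists r.
    by exists 0; rewrite leNye.
  exists C, D => t /VD Vt; apply: le_trans CP; apply: ereal_sup_ubound.
  by exists t.
have [C1 [D3 h1]] := bound _ lim1; have [C2 [D4 h2]] := bound _ lim2.
pose C := Num.max 1 (Num.max C1 C2).
pose t1 := 1 + Num.max 0 (Num.max (Num.max D1 D2) (Num.max D3 D4)).
have C0 : 0 < C by rewrite lt_max ltr01.
have C1C : C1 <= C by rewrite !le_max lexx !orbT.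
have C2C : C2 <= C by rewrite !le_max lexx !orbT.
have [t10 t1D] : 0 < t1 /\ forall D, D \in [:: D1; D2; D3; D4] -> D < t1.
  split; first by rewrite ltr_pwDl // le_max lexx.
  move=> D DD; rewrite -[D]add0r ltr_leD // !le_max.
  by move: DD; rewrite !inE => /or4P[] /eqP ->; rewrite lexx ?orbT.
have big D t : D \in [:: D1; D2; D3; D4] -> t1 <= t -> D < t.
  by move=> /t1D Dt; exact: lt_le_trans.
exists C, t1; split; [exact: C0|exact: t10| | |].
- move=> k t km tt; rewrite derive1nS derive1E.
  by apply: derivableP; apply: der => //; apply: big tt; rewrite !inE eqxx.
- move=> t tt; have Dt : D2 < t by apply: big tt; rewrite !inE eqxx orbT.
  by split; apply: (pos t Dt); rewrite ?leq_pred.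
move=> t tt.
have Dt : D2 < t by apply: big tt; rewrite !inE eqxx orbT.
have D3t : D3 < t by apply: big tt; rewrite !inE eqxx !orbT.
have D4t : D4 < t by apply: big tt; rewrite !inE eqxx !orbT.
have t_0 : 0 < t by exact: lt_le_trans tt.
have fm := pos t Dt m (leqnn m).
split.
  have := h1 t D3t; rewrite lee_fin ler_pdivrMr ?mulr_gt0 // => h.
  apply: (le_trans h); rewrite mulrA ler_pM2r // ler_pM2r //.
move=> s ts; have := h2 t D4t => h.
have : ((f^`(m)%classic s / f^`(m)%classic t)%:E <= C2%:E)%E.
  apply: le_trans h; apply: ereal_sup_ubound; exists s => //.
  by rewrite /= in_itv /= andbT.
rewrite lee_fin ler_pdivrMr // => h'.
by apply: (le_trans h'); rewrite ler_pM2r.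
Qed.

(** With [p = m - 1] steps, [v] is controlled by [g = f^(p)], and an increment of [v] is an iterated
    difference with the additional step [n' - n], hence controlled by [q = f^(p + 1)]. The growth
    bounds then follow from [g t <= C t q t] and from [q] never exceeding [C] times an earlier
    value. *)
Lemma base_fdiff hs f m t0 : class_P m t0 f -> (size hs).+1 = m ->
  all (fun h => 0 < h)%N hs -> base (fun n => fdiff hs f n%:R).
Proof.
move=> /class_P_bounds [C [t1 [C0 t10 der pos bnd]]] hm hpos; subst m.
set p := size hs in der pos bnd.
pose g : R -> R := f^`(p)%classic; pose q : R -> R := f^`(p.+1)%classic.
have gpos t : t1 <= t -> 0 < g t by move=> /pos [].
have qpos t : t1 <= t -> 0 < q t by move=> /pos [].
have gq t : t1 <= t -> g t <= C * t * q t by move=> /bnd [].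
have qq t s : t1 <= t -> t <= s -> q s <= C * q t by move=> /bnd [_ +] ts; apply.
have dg t : t1 <= t -> is_derive t 1 g (q t) by move=> tt; exact: der.
have gmono s t : t1 <= s -> s <= t -> g s <= g t.
  move=> s1 st.
  have [|c /andP[sc ct] gE] := @mvt_ge g q s t st.
    by move=> r /andP[sr _]; apply: dg; exact: le_trans sr.
  rewrite -subr_ge0 gE mulr_ge0 ?subr_ge0 //; apply/ltW/qpos.
  exact: le_trans sc.
pose Pi : R := (\prod_(h <- hs) h)%:R.
have Pi0 : 0 < Pi.
  rewrite ltr0n; elim: (hs) hpos => [|h r IH] /=; first by rewrite big_nil.
  by move=> /andP[h0 /IH r0]; rewrite big_cons muln_gt0 h0.
pose S := sumn hs.
pose v n := fdiff hs f n%:R.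
(* Beyond [n0] the total shift satisfies [S <= n], so [n + S <= 2 n], and [n / 2] is still at least
   [t1]. *)
pose n0 := (maxn S (Num.truncn (2 * t1))).+1.
have n0S n : (n0 <= n)%N -> (S <= n)%N.
  by move=> nn; apply: leq_trans nn; rewrite leqW // leq_maxl.
have n0t n : (n0 <= n)%N -> 2 * t1 <= n%:R.
  move=> nn; apply: le_trans (ltW (truncnS_gt _)) _.
  by rewrite ler_nat; apply: leq_trans nn; rewrite ltnS leq_maxr.
have n0t1 n : (n0 <= n)%N -> t1 <= n%:R by move=> /n0t; lra.
have vbound n : (n0 <= n)%N -> Pi * g n%:R <= v n <= Pi * g (n%:R + S%:R).
  move=> nn; apply: (@fdiff_bounds hs (fun k => f^`(k)%classic)).
    by move=> k s kp ns; apply: der; [exact: leqW|exact: le_trans (n0t1 n nn) ns].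
  move=> s /andP[ns sS]; have n1 := n0t1 n nn.
  by rewrite !gmono // (le_trans n1).
have dvbound n n' A B : (n0 <= n)%N -> (n <= n')%N ->
    (forall s, n%:R <= s <= n'%:R + S%:R -> A <= q s <= B) ->
    (n'%:R - n%:R) * Pi * A <= v n' - v n <= (n'%:R - n%:R) * Pi * B.
  move=> nn nn' AB.
  have -> : v n' - v n = fdiff ((n' - n)%N :: hs) f n%:R.
    by rewrite fdiff_cons -natrD subnKC.
  have -> : (n'%:R - n%:R) * Pi = (\prod_(h <- (n' - n)%N :: hs) h)%:R.
    by rewrite big_cons natrM natrB.
  apply: (@fdiff_bounds _ (fun k => f^`(k)%classic)).
    by move=> k s kp ns; apply: der => //; exact: le_trans (n0t1 n nn) ns.
  move=> s; rewrite /= natrD natrB // addrA addrCA subrr addr0; exact: AB.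
exists (2 * C ^+ 2), n0; split.
- by rewrite mulr_gt0 // exprn_gt0.
- move=> n nn; have /andP[h _] := vbound n nn; apply: lt_le_trans h.
  by rewrite mulr_gt0 // gpos // n0t1.
- move=> n n' N nn nn' n'N.
  have nN := leq_trans nn (leq_trans nn' n'N).
  have N1 := n0t1 _ nN.
  have NS : t1 <= N%:R + S%:R by rewrite ler_wpDr.
  have n'R : n'%:R <= N%:R :> R by rewrite ler_nat.
  have d0 : 0 <= n'%:R - n%:R :> R by rewrite subr_ge0 ler_nat.
  have /andP[h1 _] : (n'%:R - n%:R) * Pi * (q (N%:R + S%:R) / C) <= v n' - v n
      <= (n'%:R - n%:R) * Pi * (C * q n%:R).
    apply: dvbound => // s /andP[ns sS]; have n1 := n0t1 n nn.
    rewrite qq // andbT ler_pdivrMr // mulrC qq ?(le_trans n1) //.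
    by apply: (le_trans sS); rewrite lerD2r.
  have /andP[_ h2] := vbound N nN.
  have h3 := gq _ NS.
  have SN : S%:R <= N%:R :> R by rewrite ler_nat n0S.
  have qN := qpos _ NS.
  have h4 : C * (N%:R + S%:R) * q (N%:R + S%:R) <= C * (2 * N%:R) * q (N%:R + S%:R).
    by rewrite ler_pM2r // ler_pM2l //; lra.
  have h5 : v N <= Pi * (C * (2 * N%:R) * q (N%:R + S%:R)).
    by apply: (le_trans h2); rewrite ler_pM2l //; exact: le_trans h4.
  apply: le_trans (ler_wpM2l d0 h5) _.
  have c0 : 0 <= 2 * C ^+ 2 * N%:R by rewrite mulr_ge0 // mulr_ge0 // sqr_ge0.
  apply: le_trans (ler_wpM2l c0 h1).
  rewrite le_eqVlt; apply/orP; left; apply/eqP; field; rewrite gt_eqF //.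
move=> n n' nn nn'.
have n1 := n0t1 n nn.
have n2 : t1 <= n%:R / 2 by rewrite ler_pdivlMr // mulrC n0t.
have d0 : 0 <= n'%:R - n%:R :> R by rewrite subr_ge0 ler_nat.
have /andP[_ h1] : (n'%:R - n%:R) * Pi * 0 <= v n' - v n
      <= (n'%:R - n%:R) * Pi * (C * q n%:R).
  apply: dvbound => // s /andP[ns sS].
  by rewrite qq // andbT ltW // qpos // (le_trans n1).
have /andP[h2 _] := vbound n nn.
have n2n : n%:R / 2 <= n%:R :> R by have := ler0n R n; lra.
(* On [[n / 2, n]] the increment of [g] is [q c * n / 2] with [q n <= C * q c]; positivity of [g]
   then bounds [n * q n] by [2 C * g n]. *)
have [|c /andP[c1 c2] gE] := @mvt_ge g q _ _ n2n.
  by move=> r /andP[sr _]; apply: dg; exact: le_trans sr.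
have h3 : q n%:R <= C * q c by apply: qq => //; exact: le_trans c1.
have h4 := gpos _ n2.
have h5 : n%:R * q n%:R <= 2 * C * g n%:R.
  have : n%:R / 2 * q n%:R <= n%:R / 2 * (C * q c) by rewrite ler_wpM2l // divr_ge0.
  have : C * (q c * (n%:R - n%:R / 2)) <= C * g n%:R by rewrite ler_pM2l // -gE; lra.
  lra.
apply: le_trans (ler_wpM2l (ler0n _ n) h1) _.
have -> : n%:R * ((n'%:R - n%:R) * Pi * (C * q n%:R)) =
   (n'%:R - n%:R) * C * (Pi * (n%:R * q n%:R)) by ring.
have -> : 2 * C ^+ 2 * (n'%:R - n%:R) * v n = (n'%:R - n%:R) * C * (2 * C * v n) by ring.
apply: ler_wpM2l; first by rewrite mulr_ge0 // ltW.
have h6 : Pi * (n%:R * q n%:R) <= Pi * (2 * C * g n%:R) by rewrite ler_pM2l.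
have h7 : 2 * C * (Pi * g n%:R) <= 2 * C * v n by rewrite ler_pM2l // mulr_gt0.
lra.
Qed.

(** Each passage to [diff] prepends a step to [hs], until [m - 1] steps are reached. *)
Lemma level_fdiff r hs f m t0 : class_P m t0 f -> (r + size hs).+1 = m ->
  all (fun h => 0 < h)%N hs -> level r (fun n => fdiff hs f n%:R).
Proof.
move=> fP; elim: r hs => [|r IH] hs hm hpos /=; first exact: base_fdiff fP hm hpos.
move=> h h0.
have -> : diff (fun n : nat => fdiff hs f n%:R) h = fun n => fdiff (h :: hs) f n%:R.
  by apply/funext => n; rewrite fdiff_cons /diff natrD.
by apply: IH; rewrite /= ?h0 // -hm addnS.
Qed.

End IteratedDifferences.

(** * Power boundedness in terms of vectors, and the conclusion *)

Lemma power_bounded_rnorm (R : realType) (H : completeNormedModType R[i])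
    (T : {linear H -> H}) : power_bounded T ->
  exists2 K : R, 1 <= K & forall n v, rnorm (iter n T v) <= K * rnorm v.
Proof.
rewrite /power_bounded; set S := (X in (ereal_sup X < _)%E) => Sfin.
have [C CP] : exists C : R, (ereal_sup S <= C%:E)%E.
  case: (ereal_sup S) Sfin => [r|//|] _; first by exists r.
  by exists 0; rewrite leNye.
have unit_bound n (x : H) : rnorm x <= 1 -> rnorm (iter n T x) <= C.
  move=> x1; rewrite -lee_fin; apply: le_trans CP.
  apply: (@le_trans _ _ (op_norm (iter n T))); last first.
    by apply: ereal_sup_ubound; exists n.
  apply: ereal_sup_ubound; exists x => //=.
  by rewrite rnormE -[1]/(1%:C) lecR.
exists (Num.max 1 C) => [|n v]; first by rewrite le_max lexx.
have [->|v0] := eqVneq v 0; first by rewrite iter_lin0 rnorm0 mulr0.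
have nv : 0 < rnorm v.
  rewrite lt_def rnorm_ge0 andbT; apply: contra_neq v0; exact: rnorm_eq0.
have := unit_bound n ((rnorm v)^-1%:C *: v).
rewrite iter_linZ !rnormZ cabs_real gtr0_norm ?invr_gt0 // mulVf ?gt_eqF // => /(_ (lexx _)).
rewrite mulrC ler_pdivrMr // => h; apply: (le_trans h).
by rewrite ler_pM2r // le_max lexx orbT.
Qed.

Theorem corollary3p8 (R : realType)
  (H : completeNormedModType R[i])
  (ip : {dot H for (@Num.conj R[i])})
  (ip_norm : forall x : H, `|x| ^+ 2 = ip x x)
  (T : {linear H -> H}) (T_continuous : continuous T)
  (T_power_bounded : power_bounded T)
  (T_spectrum : point_spectrum T `&` unit_circle = set0)
  (m : nat) (t0 : R) (f : R -> R) (f_P : class_P m t0 f) (x : H) :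
  (fun N : nat =>
     N%:R^-1 *: \sum_(1 <= n < N.+1) pow_floor T t0 f n x) @ \oo --> (0 : H).
Proof.
have [K K1 TK] := power_bounded_rnorm T_power_bounded.
have noeig (z : R[i]) (v : H) : cabs z = 1 -> T v = z *: v -> v = 0.
  move=> z1 Tv; apply/eqP/negP => /negP v0.
  suff : (point_spectrum T `&` unit_circle) z by rewrite T_spectrum.
  by split; [exists v|rewrite /unit_circle /= cabsE z1].
pose u (n : nat) : R := f n%:R.
have lu : level m.-1 u.
  by apply: (level_fdiff (hs := [::]) f_P); rewrite ?addn0 // prednK // (class_P_order f_P).
have [_ iu _] := level_facts lu.
(* The default identity is the exponent [0]; it occurs for finitely many [n] only, which
   [null_floor] absorbs. *)
pose b n := if (t0 <= n%:R) && (0 <= Num.floor (f n%:R))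
  then `|Num.floor (f n%:R)|%N else 0%N.
have powE n : pow_floor T t0 f n x = iter (b n) T x by rewrite /pow_floor /b; case: ifP.
have nb : null T b x.
  have [n1 u0] := iu 0.
  apply: (@null_floor _ _ T K K1 TK (floors u) b (maxn n1 (Num.truncn t0).+1)); last first.
    by move=> y; exact: (null_level ip_norm K1 TK noeig y lu).
  move=> n; rewrite geq_max => /andP[nn1 nt0]; left.
  have fn : 0 <= f n%:R by exact: u0.
  have tn : t0 <= n%:R.
    by apply: le_trans (ltW (truncnS_gt t0)) _; rewrite ler_nat.
  by rewrite /b tn floor_ge0 fn /= /floors truncn_floor fn.
apply/cvgrPdist_le => eps eps0.
have epsE : eps = (complex.Re eps)%:C by rewrite RRe_real ?gtr0_real.
have e0 : 0 < complex.Re eps by rewrite -ltcR -epsE.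
have e20 : 0 < complex.Re eps / 2 by rewrite divr_gt0.
have [N0 N0P] := nb _ e20.
exists N0.+1 => // N /= NN0.
rewrite sub0r normrN rnormE epsE lecR.
have NR : 0 < N%:R :> R by rewrite ltr0n (leq_ltn_trans _ NN0).
rewrite -(rmorph_nat (@real_complex_def R (Phant R)) N) -fmorphV rnormZ cabs_real.
rewrite ger0_norm ?invr_ge0 ?ler0n // mulrC ler_pdivrMr //.
(* [null] sums from [0], so the index [0] gets coefficient [0] and the length becomes
   [N + 1 <= 2 N], which the halved tolerance compensates. *)
pose c n : R := if (0 < n)%N then 1 else 0.
have -> : \sum_(1 <= n < N.+1) pow_floor T t0 f n x =
    \sum_(n < N.+1) (c n)%:C *: iter (b n) T x.
  rewrite -(big_mkord xpredT (fun n => (c n)%:C *: iter (b n) T x)).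
  rewrite [RHS]big_ltn // /c ltnn scale0r add0r; apply: eq_big_nat => n /andP[n0 _].
  by rewrite powE n0 scale1r.
have c1 n : `|c n| <= 1 by rewrite /c; case: ifP; rewrite ?normr1 ?normr0.
apply: le_trans (N0P N.+1 (leqW (ltnW NN0)) c c1) _.
have N1 : 1 <= N%:R :> R by rewrite ler1n (leq_trans _ NN0).
rewrite -(natr1 N); have := ler_wpM2l (ltW e20) N1; lra.
Qed.
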